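(* There exists a finite algorithm that, for the generalized pig game with target $N$ (with die faces $0,\dots,n$ and probabilities $p_0,\dots,p_n$, where $p_0<1$), computes the value $v(N,N)$ of the game together with an optimal strategy (i.e. for every state, an action, roll or hold, such that the resulting stationary deterministic strategy is optimal). For a fixed die, this algorithm requires $O(N^3\log N)$ steps as $N\to\infty$; equivalently, in terms of the number $\mathbf{s}$ of states of the game, it requires $O(\mathbf{s}\log\mathbf{s})$ steps.
   Context: Generalized pig game (GPG). Fix a die with faces $0,1,\dots,n$ having probabilities $p_0,\dots,p_n\ge 0$, $p_0+\cdots+p_n=1$, $p_0<1$ (so that the game ends with probability one), and a target $N\ge 1$. Two players play in turns, each having a general score starting at $0$. During a turn, the player on turn rolls the die repeatedly, with turn score $\tau$ starting at $0$. If a roll gives $0$, the turn ends and the player's general score is unchanged. If a roll gives $i\ge 1$, then $i$ is added to $\tau$ and the player chooses either to roll again or to hold; holding ends the turn and adds $\tau$ to the player's general score. The first player to bring his general score to $N$ or more wins. States. A state is $(a,b,\tau,j)$, where $1\le a,b\le N$ are the numbers of points that player one and player two, respectively, still need in order to win, $j\in\{1,2\}$ is the player on turn, and $\tau$ is that player's current turn score, with $0\le\tau\le a+n-1$ if $j=1$ and $0\le\tau\le b+n-1$ if $j=2$. There is also one absorbing ''game over'' state. The number of states is denoted $\mathbf{s}$; for a fixed die, it is of order $N^3$. Actions and transitions (for $j=1$; the case $j=2$ is symmetric). At $\tau=0$ the only action is to roll; for $0<\tau<a$ the actions are roll and hold; for $\tau\ge a$ the only action is to hold, after which the game is over and player one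 has won. If player one rolls at $(a,b,\tau,1)$ with $0\le\tau<a$, the next state is $(a,b,0,2)$ with probability $p_0$ and $(a,b,\tau+i,1)$ with probability $p_i$, $i=1,\dots,n$. If he holds at $0<\tau<a$, the next state is $(a-\tau,b,0,2)$. Value. This is a zero-sum turn-based stochastic game in which player one maximizes, and player two minimizes, the probability that player one wins. It has a value and stationary deterministic optimal strategies for both players. The value $v(N,N)$ is the probability that player one wins from the initial state $(N,N,0,1)$ when both players play optimally. Steps are counted as elementary operations (arithmetic operations and comparisons on real numbers, each at unit cost). *)

(* Defs.v *)
From HB Require Import structures.
From mathcomp Require Import all_boot all_order all_algebra.
From mathcomp Require Import all_classical all_reals all_analysis.
Set Implicit Arguments.
Unset Strict Implicit.
Unset Printing Implicit Defensive.
Import Order.TTheory GRing.Theory Num.Theory.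
Import numFieldNormedType.Exports.
Local Open Scope classical_set_scope.
Local Open Scope ring_scope.

(** * The generalized pig game *)

Definition is_die (R : realType) (n : nat) (p : 'I_n.+1 -> R) : Prop :=
  [/\ forall i, 0 <= p i, \sum_(i < n.+1) p i = 1 & p ord0 < 1].

(* [State a b t j]: points still needed by players one and two, current turn
   score, and player on turn, where [true] stands for player one.  The absorbing
   "game over" state is not a [state]; it is accounted for in [nstates] and
   [win_within]. *)
Record state := State { need1 : nat; need2 : nat; turn : nat; mover : bool }.

Definition need (s : state) : nat := if mover s then need1 s else need2 s.

Definition is_state (n N : nat) (s : state) : bool :=
  [&& 1 <= need1 s <= N, 1 <= need2 s <= N & turn s <= need s + n - 1]%N.

Definition start (N : nat) : state := State N N 0 true.

(* The turn score in a state is at most [N + n - 1]; the successor counts the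
   "game over" state. *)
Definition nstates (n N : nat) : nat :=
  #|[set x : 'I_N.+1 * 'I_N.+1 * 'I_(N + n) * bool
       | let: (a, b, t, j) := x in is_state n N (State a b t j)]%SET|.+1.

Definition can_roll (s : state) : bool := (turn s < need s)%N.
Definition can_hold (s : state) : bool := (0 < turn s)%N.

Definition after_roll (s : state) (i : nat) : state :=
  let: State a b t j := s in
  if i == 0 then State a b 0 (~~ j) else State a b (t + i) j.

(* Relevant only when [turn s < need s]; otherwise holding ends the game. *)
Definition after_hold (s : state) : state :=
  let: State a b t j := s in
  if j then State (a - t) b 0 false else State a (b - t) 0 true.

(* A behavior strategy gives the probability of rolling as a function of the
   past states (oldest first) and of the current state.  The past actions need
   not be recorded, since consecutive states determine them. *)
Definition strategy (R : realType) := seq state -> state -> R.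

Definition admissible (R : realType) (n N : nat) (f : strategy R) : Prop :=
  forall h s, is_state n N s ->
    [/\ 0 <= f h s <= 1,
        ~~ can_hold s -> f h s = 1
      & ~~ can_roll s -> f h s = 0].

Definition stationary (R : realType) (d : state -> bool) : strategy R :=
  fun _ s => (d s)%:R.

(* Probability that, when player one uses [f] and player two uses [g], player
   one wins within [k] actions from state [s] with past [h]. *)
Fixpoint win_within (R : realType) (n : nat) (p : 'I_n.+1 -> R)
    (f g : strategy R) (k : nat) (h : seq state) (s : state) : R :=
  if k is k'.+1 then
    let q := if mover s then f h s else g h s in
    let next := win_within p f g k' (rcons h s) in
    q * (\sum_(i < n.+1) p i * next (after_roll s i))
    + (1 - q) * (if (need s <= turn s)%N then (mover s)%:R
                 else next (after_hold s))
  else 0.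

(* The event that player one wins is the increasing union over [k] of the
   events that he wins within [k] actions. *)
Definition win_prob (R : realType) (n : nat) (p : 'I_n.+1 -> R)
    (f g : strategy R) (s : state) : R :=
  limn (fun k => win_within p f g k [::] s).

Definition lower_value (R : realType) (n N : nat) (p : 'I_n.+1 -> R)
    (s : state) : R :=
  sup [set inf [set win_prob p f g s | g in @admissible R n N]
      | f in @admissible R n N].

Definition upper_value (R : realType) (n N : nat) (p : 'I_n.+1 -> R)
    (s : state) : R :=
  inf [set sup [set win_prob p f g s | f in @admissible R n N]
      | g in @admissible R n N].

Definition is_value (R : realType) (n N : nat) (p : 'I_n.+1 -> R)
    (s : state) (v : R) : Prop :=
  lower_value N p s = v /\ upper_value N p s = v.

(* Optimal from every initial state, against every admissible strategy of the
   opponent. *)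
Definition optimal1 (R : realType) (n N : nat) (p : 'I_n.+1 -> R)
    (f : strategy R) : Prop :=
  admissible n N f /\
  forall s, is_state n N s -> exists2 v, is_value N p s v &
    forall g, admissible n N g -> v <= win_prob p f g s.

Definition optimal2 (R : realType) (n N : nat) (p : 'I_n.+1 -> R)
    (g : strategy R) : Prop :=
  admissible n N g /\
  forall s, is_state n N s -> exists2 v, is_value N p s v &
    forall f, admissible n N f -> win_prob p f g s <= v.

(** * A real RAM, programmed in a structured language *)

(* [nats x i] and [reals x i] are the [i]-th cells of the arrays named [x].
   Natural numbers serve as addresses and counters; reals can only be stored,
   combined by field operations and compared. *)
Record memory (R : realType) :=
  Memory { nats : nat -> nat -> nat; reals : nat -> nat -> R }.

Definition upd (T : Type) (m : nat -> nat -> T) (x i : nat) (v : T) :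
    nat -> nat -> T :=
  fun y j => if (y == x) && (j == i) then v else m y j.

Inductive nexp :=
| NLit of nat
| NLoad of nat & nexp
| NAdd of nexp & nexp
| NSub of nexp & nexp
| NMul of nexp & nexp.

Inductive rexp :=
| RLit of nat
| RLoad of nat & nexp
| RAdd of rexp & rexp
| RSub of rexp & rexp
| RMul of rexp & rexp
| RDiv of rexp & rexp.

Inductive test :=
| NLe of nexp & nexp
| RLe of rexp & rexp
| TNot of test
| TAnd of test & test.

Inductive program :=
| Skip
| NStore of nat & nexp & nexp
| RStore of nat & nexp & rexp
| Seq of program & program
| If of test & program & program
| While of test & program.

Section Semantics.
Variable R : realType.
Implicit Types m : memory R.

(* Subtraction of natural numbers is truncated. *)
Fixpoint neval m (e : nexp) : nat :=
  match e with
  | NLit k => k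
  | NLoad x i => nats m x (neval m i)
  | NAdd e1 e2 => (neval m e1 + neval m e2)%N
  | NSub e1 e2 => (neval m e1 - neval m e2)%N
  | NMul e1 e2 => (neval m e1 * neval m e2)%N
  end.

(* Division by zero returns zero. *)
Fixpoint reval m (e : rexp) : R :=
  match e with
  | RLit k => k%:R
  | RLoad x i => reals m x (neval m i)
  | RAdd e1 e2 => reval m e1 + reval m e2
  | RSub e1 e2 => reval m e1 - reval m e2
  | RMul e1 e2 => reval m e1 * reval m e2
  | RDiv e1 e2 => reval m e1 / reval m e2
  end.

Fixpoint teval m (b : test) : bool :=
  match b with
  | NLe e1 e2 => (neval m e1 <= neval m e2)%N
  | RLe e1 e2 => reval m e1 <= reval m e2
  | TNot b1 => ~~ teval m b1
  | TAnd b1 b2 => teval m b1 && teval m b2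
  end.

(* Every literal, memory access, operation, comparison and connective costs
   one step. *)
Fixpoint ncost (e : nexp) : nat :=
  match e with
  | NLit _ => 1
  | NLoad _ i => (ncost i).+1
  | NAdd e1 e2 | NSub e1 e2 | NMul e1 e2 => (ncost e1 + ncost e2).+1
  end.

Fixpoint rcost (e : rexp) : nat :=
  match e with
  | RLit _ => 1
  | RLoad _ i => (ncost i).+1
  | RAdd e1 e2 | RSub e1 e2 | RMul e1 e2 | RDiv e1 e2 =>
      (rcost e1 + rcost e2).+1
  end.

Fixpoint tcost (b : test) : nat :=
  match b with
  | NLe e1 e2 => (ncost e1 + ncost e2).+1
  | RLe e1 e2 => (rcost e1 + rcost e2).+1
  | TNot b1 => (tcost b1).+1
  | TAnd b1 b2 => (tcost b1 + tcost b2).+1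
  end.

(* [exec c m m' t]: started in [m], the program [c] halts in [m'] after [t]
   steps. *)
Inductive exec : program -> memory R -> memory R -> nat -> Prop :=
| exec_skip m : exec Skip m m 1
| exec_nstore m x i e :
    exec (NStore x i e) m
      (Memory (upd (nats m) x (neval m i) (neval m e)) (reals m))
      (ncost i + ncost e).+1
| exec_rstore m x i e :
    exec (RStore x i e) m
      (Memory (nats m) (upd (reals m) x (neval m i) (reval m e)))
      (ncost i + rcost e).+1
| exec_seq c1 c2 m1 m2 m3 t1 t2 :
    exec c1 m1 m2 t1 -> exec c2 m2 m3 t2 ->
    exec (Seq c1 c2) m1 m3 (t1 + t2)
| exec_if_true b c1 c2 m m' t :
    teval m b -> exec c1 m m' t -> exec (If b c1 c2) m m' (tcost b + t)
| exec_if_false b c1 c2 m m' t :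
    ~~ teval m b -> exec c2 m m' t -> exec (If b c1 c2) m m' (tcost b + t)
| exec_while_false b c m :
    ~~ teval m b -> exec (While b c) m m (tcost b)
| exec_while_true b c m1 m2 m3 t1 t2 :
    teval m1 b -> exec c m1 m2 t1 -> exec (While b c) m2 m3 t2 ->
    exec (While b c) m1 m3 (tcost b + t1 + t2).

End Semantics.

(** * Input and output conventions *)

(* [N] and [n] are in cells 0 and 1 of array 0 of naturals, [p_0, ..., p_n] in
   cells 0, ..., n of array 0 of reals; every other cell is zero. *)
Definition input (R : realType) (n : nat) (p : 'I_n.+1 -> R) (N : nat) :
    memory R :=
  Memory
    (fun x i => if x == 0%N then nth 0%N [:: N; n] i else 0%N)
    (fun x i => if x == 0%N then oapp p 0 (insub i) else 0).

Definition output_value (R : realType) (m : memory R) : R := reals m 1 0.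

(* Array 1 (resp. 2) of naturals holds the actions of player one (resp. two),
   indexed by [(a, b, t)] in row-major order; a nonzero entry means "roll". *)
Definition output_action (R : realType) (n N : nat) (m : memory R)
    (s : state) : bool :=
  nats m (if mover s then 1 else 2)%N
    ((need1 s * N.+1 + need2 s) * (N + n) + turn s)%N != 0%N.

(* Main.v *)
(* A player in need of [a] points with turn score [t] faces the decisions of a
   player in need of [a - t] points at the start of a turn, except for the value
   [y] of losing the turn.  So, against an opponent in need of [b] points, the
   value of rolling is a convex piecewise linear function of [y] that depends on
   [r = a - t] and [b] only, and the values of the two turn starts with needs
   [a] and [b] are where two such functions cross.
   For fixed [b] the relevant [y] decreases as [a] increases, and rolling is
   worth the less the smaller [y] is.  Hence each decision changes from roll to
   hold at most once in the whole computation: one may follow the pieces of the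
   functions downwards, solving a 2x2 linear system for the current pieces and
   going on to the next piece while the solution lies below its left end.  There
   are O(N^2) pairs [(a, b)] and O(N^2) changes, and each such step takes O(N)
   operations, which even gives O(N^3). *)
Require Import Defs.
From HB Require Import structures.
From mathcomp Require Import all_boot all_order all_algebra.
From mathcomp Require Import all_classical all_reals all_analysis.
From mathcomp Require Import zify ring lra.
Set Implicit Arguments.
Unset Strict Implicit.
Unset Printing Implicit Defensive.
Import Order.TTheory GRing.Theory Num.Theory.
Import numFieldNormedType.Exports.
Local Open Scope classical_set_scope.
Local Open Scope ring_scope.

(** A decision has to be corrected before the values it depends on are known. While both lists of
    decisions may still contain wrong rolls, the crossing of the two current lines can be far from
    the true one, on either side. Only one-sided information makes a correction safe: fixed
    decisions never earn more than optimal ones, so a line lies below its function, and it touches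
    the function wherever its decisions are optimal. The invariant is that each list is optimal at
    some point [top] not below the value sought. Then a hold is never wrong and only rolls have to
    be revised. The invariant passes to the next need because the decision that comes in is a roll,
    which is right there. Since [p ord0 < 1], all slopes are below 1; hence crossings are unique and
    the linear systems regular. That the numbers found are the values of the game is a separate
    matter: any solution of the optimality equations with values in [0, 1] is the value, because the
    game ends at a geometric rate whatever the players do. *)

(** * The optimality equations *)

Section Game.
Variables (R : realType) (n : nat) (p : 'I_n.+1 -> R).
Hypothesis die_p : is_die p.
Implicit Types (u : state -> R) (d : state -> bool) (s : state).

Let p_ge0 i : 0 <= p i. Proof. by case: die_p. Qed.
Let p_sum : \sum_i p i = 1. Proof. by case: die_p. Qed.

Definition roll_value u s : R := \sum_(i < n.+1) p i * u (after_roll s i).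

Definition hold_value u s : R :=
  if (need s <= turn s)%N then (mover s)%:R else u (after_hold s).

Definition mix_value (q : R) u s : R :=
  q * roll_value u s + (1 - q) * hold_value u s.

Definition legal_prob (q : R) s : Prop :=
  [/\ 0 <= q <= 1, ~~ can_hold s -> q = 1 & ~~ can_roll s -> q = 0].

Definition bellman u s : R :=
  if ~~ can_roll s then hold_value u s
  else if ~~ can_hold s then roll_value u s
  else if mover s then Num.max (roll_value u s) (hold_value u s)
  else Num.min (roll_value u s) (hold_value u s).

(** The test [d s == mover s] joins two cases, the maximizer rolling and the minimizer holding: both
    are right if holding is worth no more than rolling. *)
Definition greedy d u s : Prop :=
  [/\ ~~ can_hold s -> d s, ~~ can_roll s -> ~~ d s
    & can_roll s -> can_hold s ->
      if d s == mover s then hold_value u s <= roll_value u s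
      else roll_value u s <= hold_value u s].

Lemma is_state_roll N s i : (i <= n)%N -> is_state n N s -> can_roll s ->
  is_state n N (after_roll s i).
Proof.
case: s => a b t j in_; rewrite /is_state /can_roll /= /need /=.
by case: (i == 0)%N; case: j => /=; lia.
Qed.

Lemma is_state_hold N s : is_state n N s -> can_roll s ->
  is_state n N (after_hold s).
Proof.
case: s => a b t j; rewrite /is_state /can_roll /= /need /=.
by case: j => /=; lia.
Qed.

Lemma roll_value_le N s u u' : is_state n N s -> can_roll s ->
  (forall s', is_state n N s' -> u s' <= u' s') ->
  roll_value u s <= roll_value u' s.
Proof.
move=> sN rs le_uu; apply: ler_sum => i _; apply: ler_wpM2l => //.
by apply: le_uu; apply: is_state_roll; rewrite // -ltnS.
Qed.

Lemma hold_value_le N s u u' : is_state n N s ->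
  (forall s', is_state n N s' -> u s' <= u' s') ->
  hold_value u s <= hold_value u' s.
Proof.
move=> sN le_uu; rewrite /hold_value; case: leqP => // rs.
by apply: le_uu; apply: is_state_hold.
Qed.

(** Where rolling is forbidden, [after_roll] may leave the state space; legality forces [q = 0]
    there, so it suffices to compare [u] and [u'] on states. *)
Lemma mix_value_le N s q u u' : is_state n N s -> legal_prob q s ->
  (forall s', is_state n N s' -> u s' <= u' s') ->
  mix_value q u s <= mix_value q u' s.
Proof.
move=> sN [/andP[q0 q1] _ qr] le_uu; apply: lerD; last first.
  by rewrite ler_wpM2l ?subr_ge0 //; apply: hold_value_le le_uu.
have [rs|/qr ->] := boolP (can_roll s); last by rewrite !mul0r.
by rewrite ler_wpM2l //; apply: roll_value_le le_uu.
Qed.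

Lemma roll_valueB u w s :
  roll_value (fun s' => u s' - w s') s = roll_value u s - roll_value w s.
Proof. by rewrite /roll_value -sumrB; apply: eq_bigr => i _; rewrite mulrBr. Qed.

Lemma roll_value1 s : roll_value (fun=> 1) s = 1.
Proof. by rewrite /roll_value -[RHS]p_sum; apply: eq_bigr => i _; rewrite mulr1. Qed.

Lemma greedy_legal d u N s : is_state n N s -> greedy d u s ->
  legal_prob (d s)%:R s.
Proof.
move=> sN [dh dr _]; split; first by case: (d s); rewrite !lexx ler01.
  by move=> /dh ->.
by move=> /dr /negPf ->.
Qed.

Lemma bellman_greedy d u s : greedy d u s ->
  bellman u s = mix_value (d s)%:R u s.
Proof.
case=> dh dr drh; rewrite /bellman /mix_value.
have [rs|/dr/negPf->] /= := boolP (can_roll s); last by rewrite subr0 mul0r mul1r add0r.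
have [hs|/dh->] /= := boolP (can_hold s); last by rewrite subrr mul1r mul0r addr0.
move: (drh rs hs).
case: (d s); case: (mover s) => /= le_rh;
  rewrite ?subrr ?subr0 ?mul1r ?mul0r ?addr0 ?add0r.
- by apply/max_idPl.
- by apply/min_idPl.
- by apply/max_idPr.
- by apply/min_idPr.
Qed.

Lemma mix_value_bellman q u s : legal_prob q s ->
  if mover s then mix_value q u s <= bellman u s
  else bellman u s <= mix_value q u s.
Proof.
case=> /andP[q0 q1] qh qr; rewrite /bellman /mix_value.
have [rs|/qr ->] /= := boolP (can_roll s); last first.
  by rewrite subr0 mul0r mul1r add0r lexx if_same.
have [hs|/qh->] /= := boolP (can_hold s); last first.
  by rewrite subrr mul1r mul0r addr0 lexx if_same.
set r := roll_value u s; set h := hold_value u s.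
case: (mover s).
  have: r <= Num.max r h by rewrite le_max lexx.
  have: h <= Num.max r h by rewrite le_max lexx orbT.
  by move: (Num.max r h) => x hx rx; nra.
have: Num.min r h <= r by rewrite ge_min lexx.
have: Num.min r h <= h by rewrite ge_min lexx orbT.
by move: (Num.min r h) => x hx rx; nra.
Qed.

(** * The game ends exponentially fast *)

(* Decreases at every action except when a zero is rolled. *)
Definition progress s : nat :=
  (2 * (need1 s + need2 s) - minn (turn s) (need s))%N.

Let q := 1 - p ord0.
Let eps := q / 2.
Let q_gt0 : 0 < q. Proof. by rewrite /q subr_gt0; case: die_p. Qed.
Let p0_ge0 : 0 <= p ord0. Proof. exact: p_ge0. Qed.

(** A Lyapunov function. A zero may undo all progress, but the potential never exceeds 2; a nonzero
    face, of total probability [q = 2 * eps], lowers [progress]. The choice of [eps] bounds the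
    expected potential after a roll by [2 - 2 * eps ^+ (progress s).+1]. *)
Definition potential s : R := 2 - eps ^+ (progress s).+1.

(** On states [progress] is at most [4 * N], which makes the factor uniform in the state. *)
Definition decay N : R := 1 - eps ^+ (4 * N)%N.+1 / 2.

Let eps_gt0 : 0 < eps. Proof. by rewrite divr_gt0. Qed.
Let eps_le : eps <= 1 / 2. Proof. by rewrite /eps ler_wpM2r // /q gerBl. Qed.
Let epsX_gt0 k : 0 < eps ^+ k. Proof. exact: exprn_gt0. Qed.
Let epsX_le k l : (l <= k)%N -> eps ^+ k <= eps ^+ l.
Proof.
by move=> lk; apply: ler_wiXn2l => //; [exact: ltW | apply: le_trans eps_le _; lra].
Qed.
Let epsX_le1 k : eps ^+ k <= 1. Proof. by rewrite -(expr0 eps) epsX_le. Qed.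

Lemma decay_ge0 N : 0 <= decay N < 1.
Proof.
rewrite /decay; have := epsX_gt0 (4 * N)%N.+1; have := epsX_le1 (4 * N)%N.+1.
by move: (eps ^+ _) => x *; apply/andP; split; lra.
Qed.

Lemma potential_bounds s : 1 <= potential s <= 2.
Proof.
rewrite /potential; have := epsX_gt0 (progress s).+1; have := epsX_le1 (progress s).+1.
by move: (eps ^+ _) => x *; apply/andP; split; lra.
Qed.

Lemma potential_step N s : is_state n N s ->
  2 - 2 * eps ^+ (progress s).+1 <= decay N * potential s.
Proof.
move=> sN; rewrite /decay /potential.
have : eps ^+ (4 * N)%N.+1 <= eps ^+ (progress s).+1.
  by apply: epsX_le; move: sN; rewrite /is_state /progress; lia.
have := epsX_gt0 (progress s).+1; have := epsX_gt0 (4 * N)%N.+1.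
have := epsX_le1 (progress s).+1.
by move: (eps ^+ _) (eps ^+ _) => x y; nra.
Qed.

Lemma potential_roll N s : is_state n N s -> can_roll s ->
  roll_value potential s <= decay N * potential s.
Proof.
move=> sN rs; apply: le_trans (potential_step sN).
rewrite /roll_value big_ord_recl /=.
have q_sum : \sum_(i < n) p (lift ord0 i) = q.
  by rewrite /q -p_sum big_ord_recl /=; ring.
have : \sum_(i < n) p (lift ord0 i) * potential (after_roll s (bump 0 i))
   <= q * (2 - eps ^+ progress s).
  rewrite -q_sum mulr_suml; apply: ler_sum => i _; apply: ler_wpM2l => //.
  rewrite lerB //; apply: epsX_le.
  move: rs; case: s sN => a b t j; rewrite /is_state /can_roll /progress /need /=.
  by rewrite /bump leq0n; case: j => /=; lia.
have /andP[_] := potential_bounds (after_roll s 0).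
move: (potential _) (\sum_(i < n) _) => x y x2 yq.
have px : p ord0 * x <= p ord0 * 2 by rewrite ler_wpM2l.
rewrite exprS (_ : 2 * (eps * _) = q * eps ^+ progress s); last by rewrite /eps; field.
apply: le_trans (lerD px yq) _.
by rewrite le_eqVlt; apply/orP; left; apply/eqP; rewrite /q; ring.
Qed.

Lemma potential_hold N s : is_state n N s -> can_roll s -> can_hold s ->
  potential (after_hold s) <= decay N * potential s.
Proof.
move=> sN rs hs; apply: le_trans (potential_step sN).
rewrite /potential.
have : eps ^+ (progress s) <= eps ^+ (progress (after_hold s)).+1.
  apply: epsX_le; move: sN rs hs; case: s => a b t j.
  by rewrite /is_state /can_roll /can_hold /progress /need /=; case: j => /=; lia.
have : eps * eps ^+ progress s <= 1 / 2 * eps ^+ progress s.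
  by rewrite ler_wpM2r // ltW.
rewrite (exprS _ (progress s)) => le1 le2; apply: le_trans (lerB (lexx 2) le2) _.
by rewrite lerB //; lra.
Qed.

(** Any legal mixture of actions turns a deficit of [c * potential] at the successors into one
    smaller by the factor [decay N]: the induction step for the lower bound on truncated games. *)
Lemma mix_value_potential N s r u (c : R) : is_state n N s -> legal_prob r s -> 0 <= c ->
  mix_value r u s - decay N * c * potential s <=
  mix_value r (fun s' => u s' - c * potential s') s.
Proof.
move=> sN [/andP[r0 r1] rh rr] c0; rewrite /mix_value.
rewrite (roll_valueB u (fun s' => c * potential s')).
have -> : roll_value (fun s' => c * potential s') s = c * roll_value potential s.
  by rewrite /roll_value mulr_sumr; apply: eq_bigr => i _; ring.
have /andP[d0 d1] := decay_ge0 N; have /andP[p1 p2] := potential_bounds s.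
have Dp : 0 <= c * (decay N * potential s) by rewrite !mulr_ge0 //; lra.
have [rs|nr] := boolP (can_roll s); last first.
  rewrite (rr nr) !mul0r subr0 !mul1r !add0r /hold_value.
  by move: nr; rewrite /can_roll -leqNgt => ->; lra.
have Hr : c * roll_value potential s <= c * (decay N * potential s).
  by rewrite ler_wpM2l // potential_roll.
have [hs|nh] := boolP (can_hold s); last first.
  by rewrite (rh nh) subrr !mul0r !mul1r; lra.
have Hh : hold_value u s - c * (decay N * potential s) <=
    hold_value (fun s' => u s' - c * potential s') s.
  rewrite /hold_value; case: ifP => _; first lra.
  by rewrite lerB // ler_wpM2l // potential_hold.
move: (hold_value _ s) (hold_value _ s) Hh Hr => h h' Hh Hr.
move: Hh Hr; move: (roll_value u s) (roll_value potential s) => x y.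
by nra.
Qed.

(** * Verification of optimality *)

Section Verification.
Variables (N : nat) (u : state -> R) (d : state -> bool).
Hypothesis u01 : forall s, is_state n N s -> 0 <= u s <= 1.
Hypothesis u_fix : forall s, is_state n N s -> u s = bellman u s.
Hypothesis d_greedy : forall s, is_state n N s -> greedy d u s.

Lemma admissible_legal f h s : admissible n N f -> is_state n N s ->
  legal_prob (f h s : R) s.
Proof. by move=> fN sN; case: (fN h s sN). Qed.

Lemma greedy_admissible : admissible n N (@stationary R d).
Proof. by move=> h s sN; have := greedy_legal sN (d_greedy sN). Qed.

Lemma win_withinS f g k h s : win_within p f g k.+1 h s =
  mix_value (if mover s then f h s else g h s)
    (win_within p f g k (rcons h s)) s.
Proof. by []. Qed.

Lemma win_within_bounds f g k h s :
    admissible n N f -> admissible n N g -> is_state n N s ->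
  0 <= win_within p f g k h s <= 1.
Proof.
move=> fN gN; elim: k h s => [|k IHk] h s sN; first by rewrite lexx ler01.
rewrite win_withinS; set r := (if _ then _ else _).
have lr : legal_prob r s by rewrite /r; case: (mover s); apply: admissible_legal.
have [/andP[r0 r1] _ _] := lr.
have roll01 w : (forall s', is_state n N s' -> 0 <= w s' <= 1) -> can_roll s ->
    0 <= roll_value w s <= 1.
  move=> w01 rs; apply/andP; split.
    apply: sumr_ge0 => i _; apply: mulr_ge0 => //.
    by have /w01/andP[] := is_state_roll (ltn_ord i : (i <= n)%N) sN rs.
  rewrite -(roll_value1 s); apply: roll_value_le sN rs _ => s' /w01 /andP[] //.
have hold01 w : (forall s', is_state n N s' -> 0 <= w s' <= 1) ->
    0 <= hold_value w s <= 1.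
  move=> w01; rewrite /hold_value; case: leqP => [_|rs].
    by case: (mover s); rewrite !lexx ler01.
  by apply: w01; apply: is_state_hold.
have /hold01 := IHk (rcons h s).
have [rs|nr] := boolP (can_roll s); last first.
  by case: lr => _ _ /(_ nr) ->; rewrite /mix_value mul0r subr0 mul1r add0r.
have /roll01 /(_ rs) := IHk (rcons h s).
rewrite /mix_value; move: (roll_value _ _) (hold_value _ _) => x y.
move=> /andP[x0 x1] /andP[y0 y1].
have s0 : 0 <= 1 - r by lra.
apply/andP; split; first by rewrite addr_ge0 // mulr_ge0.
have: r * x <= r * 1 by rewrite ler_wpM2l.
have: (1 - r) * y <= (1 - r) * 1 by rewrite ler_wpM2l.
lra.
Qed.

Lemma win_within_mono f g k h s :
    admissible n N f -> admissible n N g -> is_state n N s ->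
  win_within p f g k h s <= win_within p f g k.+1 h s.
Proof.
move=> fN gN; elim: k h s => [|k IHk] h s sN.
  by have /andP[] := @win_within_bounds f g 1 h s fN gN sN.
rewrite win_withinS [leRHS]win_withinS.
apply: mix_value_le (sN) _ _ => [|s' s'N]; last exact: IHk.
by case: (mover s); apply: admissible_legal.
Qed.

Lemma win_prob_cvg f g s :
    admissible n N f -> admissible n N g -> is_state n N s ->
  cvgn (fun k => win_within p f g k [::] s).
Proof.
move=> fN gN sN; apply: nondecreasing_is_cvgn.
  by apply/nondecreasing_seqP => k; apply: win_within_mono.
by exists 1 => _ [k _ <-]; have /andP[] := @win_within_bounds f g k [::] s fN gN sN.
Qed.

Lemma win_prob_bounds f g s :
    admissible n N f -> admissible n N g -> is_state n N s ->
  0 <= win_prob p f g s <= 1.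
Proof.
move=> fN gN sN; rewrite /win_prob; have cv := win_prob_cvg fN gN sN.
apply/andP; split; [apply: limr_ge|apply: limr_le] => //; apply: nearW => k;
  by have /andP[] := @win_within_bounds f g k [::] s fN gN sN.
Qed.

(** Truncation counts an unfinished play as lost by player one, which can only help this bound; the
    induction starts from [0 <= u]. *)
Lemma win_within_le f k h s : admissible n N f -> is_state n N s ->
  win_within p f (stationary R d) k h s <= u s.
Proof.
move=> fN; elim: k h s => [|k IHk] h s sN.
  by have /andP[] := u01 sN.
rewrite win_withinS; set r := (if _ then _ else _).
have lr : legal_prob r s.
  by rewrite /r; case: (mover s); apply: admissible_legal => //; exact: greedy_admissible.
apply: (@le_trans _ _ (mix_value r u s)).
  by apply: mix_value_le sN lr _ => s' s'N; apply: IHk.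
rewrite (u_fix sN); have := @mix_value_bellman r u s lr.
rewrite /r; case: (mover s) => // _.
by rewrite (bellman_greedy (d_greedy sN)).
Qed.

(** Here unfinished plays count against the bound, and the potential pays for them. At [k = 0] the
    deficit covers [u s] because the potential is at least 1. *)
Lemma win_within_ge g k h s : admissible n N g -> is_state n N s ->
  u s - decay N ^+ k * potential s <= win_within p (stationary R d) g k h s.
Proof.
move=> gN; elim: k h s => [|k IHk] h s sN.
  rewrite expr0 mul1r subr_le0; have /andP[_] := u01 sN.
  by have /andP[] := potential_bounds s; lra.
rewrite win_withinS; set r := (if _ then _ else _).
have lr : legal_prob r s.
  by rewrite /r; case: (mover s); apply: admissible_legal => //; exact: greedy_admissible.
have /andP[d0 d1] := decay_ge0 N.
have le1 : mix_value r (fun s' => u s' - decay N ^+ k * potential s') s <=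
    mix_value r (win_within p (stationary R d) g k (rcons h s)) s.
  by apply: mix_value_le sN lr _ => s' s'N; apply: IHk.
apply: le_trans le1; apply: le_trans (mix_value_potential u sN lr _); last exact: exprn_ge0.
rewrite -exprS lerB //.
rewrite (u_fix sN); have := @mix_value_bellman r u s lr.
rewrite /r; case: (mover s) => // _.
by rewrite (bellman_greedy (d_greedy sN)).
Qed.

Lemma win_prob_le f s : admissible n N f -> is_state n N s ->
  win_prob p f (stationary R d) s <= u s.
Proof.
move=> fN sN; apply: limr_le.
  by apply: (win_prob_cvg fN _ sN); exact: greedy_admissible.
by apply: nearW => k; apply: win_within_le.
Qed.

Lemma win_prob_ge g s : admissible n N g -> is_state n N s ->
  u s <= win_prob p (stationary R d) g s.
Proof.
move=> gN sN; rewrite /win_prob.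
have cv := win_prob_cvg greedy_admissible gN sN.
have cvd : u s - decay N ^+ k * potential s @[k --> \oo] --> u s - 0 * potential s.
  apply: cvgB; first exact: cvg_cst.
  apply: cvgM; last exact: cvg_cst.
  by apply: cvg_expr; have /andP[d0 d1] := decay_ge0 N; rewrite ger0_norm.
have <- : limn (fun k => u s - decay N ^+ k * potential s) = u s.
  by rewrite -[RHS]subr0 -(mul0r (potential s)); apply/cvg_lim.
apply: ler_lim => //; first by apply/cvg_ex; eexists; exact: cvd.
by apply: nearW => k; apply: win_within_ge.
Qed.

(** The greedy strategy serves twice: as player two's reply it caps every infimum by [u s], and as
    player one's choice it reaches that cap. *)
Lemma lower_value_eq s : is_state n N s -> lower_value N p s = u s.
Proof.
move=> sN; rewrite /lower_value.
have ne : [set win_prob p (stationary R d) g s | g in @admissible R n N] !=set0.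
  by exists (win_prob p (stationary R d) (stationary R d) s); exists (@stationary R d) => //;
    exact: greedy_admissible.
have inf_le f : admissible n N f ->
    inf [set win_prob p f g s | g in @admissible R n N] <= u s.
  move=> fN; apply: le_trans (win_prob_le fN sN); apply: ge_inf.
    by exists 0 => _ [g gN <-]; have /andP[] := win_prob_bounds fN gN sN.
  by exists (@stationary R d) => //; exact: greedy_admissible.
apply/eqP; rewrite eq_le; apply/andP; split.
  apply: ge_sup; last by move=> _ [f fN <-]; apply: inf_le.
  by eexists; exists (@stationary R d); [exact: greedy_admissible|].
apply: (@le_trans _ _ (inf [set win_prob p (stationary R d) g s | g in @admissible R n N])).
  by apply: lb_le_inf => // _ [g gN <-]; apply: win_prob_ge.
apply: ub_le_sup; first by exists (u s) => _ [f fN <-]; apply: inf_le.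
by exists (@stationary R d) => //; exact: greedy_admissible.
Qed.

Lemma upper_value_eq s : is_state n N s -> upper_value N p s = u s.
Proof.
move=> sN; rewrite /upper_value.
have ne : [set win_prob p f (stationary R d) s | f in @admissible R n N] !=set0.
  by exists (win_prob p (stationary R d) (stationary R d) s); exists (@stationary R d) => //;
    exact: greedy_admissible.
have sup_ge g : admissible n N g ->
    u s <= sup [set win_prob p f g s | f in @admissible R n N].
  move=> gN; apply: le_trans (win_prob_ge gN sN) _; apply: ub_le_sup.
    by exists 1 => _ [f fN <-]; have /andP[] := win_prob_bounds fN gN sN.
  by exists (@stationary R d) => //; exact: greedy_admissible.
apply/eqP; rewrite eq_le; apply/andP; split; last first.
  apply: lb_le_inf; last by move=> _ [g gN <-]; apply: sup_ge.
  by eexists; exists (@stationary R d); [exact: greedy_admissible|].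
apply: (@le_trans _ _ (sup [set win_prob p f (stationary R d) s | f in @admissible R n N])).
  apply: ge_inf; first by exists (u s) => _ [g gN <-]; apply: sup_ge.
  by exists (@stationary R d) => //; exact: greedy_admissible.
by apply: ge_sup => // _ [f fN <-]; apply: win_prob_le.
Qed.

Lemma greedy_is_value s : is_state n N s -> is_value N p s (u s).
Proof. by move=> sN; split; [exact: lower_value_eq|exact: upper_value_eq]. Qed.

Lemma greedy_optimal1 : optimal1 N p (stationary R d).
Proof.
split=> [|s sN]; first exact: greedy_admissible.
by exists (u s); [exact: greedy_is_value|move=> g gN; exact: win_prob_ge].
Qed.

Lemma greedy_optimal2 : optimal2 N p (stationary R d).
Proof.
split=> [|s sN]; first exact: greedy_admissible.
by exists (u s); [exact: greedy_is_value|move=> g gN; exact: win_prob_le].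
Qed.

End Verification.

End Game.

(** * Value iteration and the symmetry between the players *)

Section Value.
Variables (R : realType) (n : nat) (p : 'I_n.+1 -> R).
Hypothesis die_p : is_die p.
Implicit Types (u : state -> R) (s : state).

Let p_ge0 i : 0 <= p i. Proof. by case: die_p. Qed.

Lemma bellman_le u u' s s' :
    can_roll s = can_roll s' -> can_hold s = can_hold s' -> mover s = mover s' ->
    roll_value p u s <= roll_value p u' s' -> hold_value u s <= hold_value u' s' ->
  bellman p u s <= bellman p u' s'.
Proof.
move=> er eh em ler leh; rewrite /bellman er eh em.
case: ifP => // _; case: ifP => // _; case: ifP => _.
  by rewrite ge_max !le_max ler leh orbT.
by rewrite le_min !ge_min ler leh orbT.
Qed.

Lemma roll_value_le_all u u' s s' :
    (forall i, (i <= n)%N -> u (after_roll s i) <= u' (after_roll s' i)) ->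
  roll_value p u s <= roll_value p u' s'.
Proof.
move=> le_uu; apply: ler_sum => i _; apply: ler_wpM2l => //.
by apply: le_uu; rewrite -ltnS.
Qed.

(** Starting from 0 makes the iterates nondecreasing, so monotonicity and boundedness alone give the
    limit. *)
Definition value_iter k : state -> R := iter k (bellman p) (fun=> 0).

Lemma value_iter_bounds k s : 0 <= value_iter k s <= 1.
Proof.
elim: k s => [|k IHk] s; first by rewrite lexx ler01.
have r01 : 0 <= roll_value p (value_iter k) s <= 1.
  apply/andP; split.
    by apply: sumr_ge0 => i _; apply: mulr_ge0 => //; case/andP: (IHk (after_roll s i)).
  rewrite -(roll_value1 die_p s); apply: roll_value_le_all => i _.
  by case/andP: (IHk (after_roll s i)).
have h01 : 0 <= hold_value (value_iter k) s <= 1.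
  by rewrite /hold_value; case: ifP => // _; case: (mover s); rewrite !lexx ler01.
rewrite /= /bellman; case: ifP => // _; case: ifP => // _.
case/andP: r01 => r0 r1; case/andP: h01 => h0 h1.
by case: ifP => _; rewrite ?ge_max ?le_max ?le_min ?ge_min ?r0 ?r1 ?h0 ?h1.
Qed.

Lemma value_iter_mono k s : value_iter k s <= value_iter k.+1 s.
Proof.
elim: k s => [|k IHk] s; first by case/andP: (value_iter_bounds 1 s).
apply: bellman_le => //; first by apply: roll_value_le_all.
by rewrite /hold_value; case: ifP.
Qed.

Definition game_value s : R := limn (fun k => value_iter k s).

Lemma value_iter_cvg s : value_iter k s @[k --> \oo] --> game_value s.
Proof.
apply: (nondecreasing_is_cvgn (u_ := fun k => value_iter k s)).
  by apply/nondecreasing_seqP => k; apply: value_iter_mono.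
by exists 1 => _ [k _ <-]; case/andP: (value_iter_bounds k s).
Qed.

Lemma game_value_bounds s : 0 <= game_value s <= 1.
Proof.
have cv := cvgP _ (@value_iter_cvg s).
apply/andP; split; [apply: limr_ge|apply: limr_le] => //; apply: nearW => k;
  by case/andP: (value_iter_bounds k s).
Qed.

Lemma game_value_le s s' : (forall k, value_iter k s <= value_iter k s') ->
  game_value s <= game_value s'.
Proof.
move=> le_ss; apply: ler_lim; try exact: (cvgP _ (@value_iter_cvg _)).
exact: nearW.
Qed.

Lemma game_valueE s : game_value s = bellman p game_value s.
Proof.
have roll_cvg : roll_value p (value_iter k) s @[k --> \oo] --> roll_value p game_value s.
  apply: cvg_big => [x|i _]; first exact: add_continuous.
  by apply: cvgM; [exact: cvg_cst|exact: value_iter_cvg].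
have hold_cvg : hold_value (value_iter k) s @[k --> \oo] --> hold_value game_value s.
  by rewrite /hold_value; case: ifP => _; [exact: cvg_cst|exact: value_iter_cvg].
have : bellman p (value_iter k) s @[k --> \oo] --> bellman p game_value s.
  rewrite /bellman; case: ifP => // _; case: ifP => // _; case: ifP => _.
    (* Maximum and minimum are written with absolute values so that limits pass through them. *)
    under eq_fun => k do rewrite maxr_absE.
    rewrite maxr_absE; apply: cvgM; [|exact: cvg_cst]; apply: cvgD; first exact: cvgD.
    by apply: cvg_norm; apply: cvgB.
  under eq_fun => k do rewrite minr_absE.
  rewrite minr_absE; apply: cvgM; [|exact: cvg_cst]; apply: cvgB; first exact: cvgD.
  by apply: cvg_norm; apply: cvgB.
move=> bc; have : value_iter k.+1 s @[k --> \oo] --> game_value s.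
  by rewrite (cvg_shiftS (fun k => value_iter k s)); exact: value_iter_cvg.
by move=> vc; apply: (cvg_unique _ vc bc).
Qed.

Lemma value_iter_need2 k a b t j :
  value_iter k (State a b t j) <= value_iter k (State a b.+1 t j).
Proof.
elim: k a b t j => // k IHk a b t [].
  apply: bellman_le => //; first by apply: roll_value_le_all => i _ /=; case: ifP.
  by rewrite /hold_value /need /=; case: ifP.
(* If [b <= t], player two can only hold and win, so the left side is 0. *)
have [bt|tb] := leqP b t.
  apply: le_trans (_ : 0 <= _); last by case/andP: (value_iter_bounds k.+1 (State a b.+1 t false)).
  by rewrite /= /bellman /can_roll /need /= ltnNge bt /= /hold_value /need /= bt.
apply: bellman_le => //.
- by rewrite /can_roll /need /= tb ltnS ltnW.
- by apply: roll_value_le_all => i _ /=; case: ifP.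
- by rewrite /hold_value /need /= (leqNgt b) tb (ltnNge b) (ltnW tb) /= subSn // ltnW.
Qed.

Lemma game_value_need2 a b b' t j : (b <= b')%N ->
  game_value (State a b t j) <= game_value (State a b' t j).
Proof.
elim: b' => [|b' IHb]; first by rewrite leqn0 => /eqP ->.
rewrite leq_eqVlt => /orP[/eqP<- //|/IHb] /le_trans; apply.
by apply: game_value_le => k; apply: value_iter_need2.
Qed.

Lemma greedy_exists u : exists d, forall s, (can_roll s || can_hold s) -> greedy p d u s.
Proof.
exists (fun s => can_roll s && (~~ can_hold s ||
  (mover s == (if mover s then hold_value u s <= roll_value p u s
               else roll_value p u s > hold_value u s)))) => s rh.
split.
- by move=> nh; move: rh; rewrite nh (negPf nh) orbF => ->.
- by move=> /negPf ->.
- move=> -> -> /=; case: (mover s) => /=; first by case: (leP (hold_value u s)) => /= [//|/ltW].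
  by case: (ltP (hold_value u s)) => /= [/ltW|].
Qed.

Definition swap s := State (need2 s) (need1 s) (turn s) (~~ mover s).

Lemma is_state_rh N s : is_state n N s -> can_roll s || can_hold s.
Proof.
case: s => a b t j; rewrite /is_state /can_roll /can_hold /need /=.
by case: j; lia.
Qed.

(** Exchanging the players turns a solution of the optimality equations into another one. Both are
    the lower value of the game, hence equal on states. *)
Lemma game_value_swap N s : is_state n N s -> game_value (swap s) = 1 - game_value s.
Proof.
move=> sN; pose u s := 1 - game_value (swap s).
have u01 s' : 0 <= u s' <= 1.
  by rewrite /u; case/andP: (game_value_bounds (swap s')) => *; apply/andP; split; lra.
have u_fix s' : u s' = bellman p u s'.
  have Er : roll_value p u s' = 1 - roll_value p game_value (swap s').
    have := roll_valueB p (fun=> 1) (fun s => game_value (swap s)) s'.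
    rewrite (roll_value1 die_p) => ->; congr (1 - _); apply: eq_bigr => i _.
    by case: s' => a b t j /=; case: ifP.
  have Eh : hold_value u s' = 1 - hold_value game_value (swap s').
    rewrite /hold_value /u; case: (s') => a b t [] /=; rewrite /need /=;
      by case: ifP => //; rewrite ?subr0 ?subrr.
  rewrite /u game_valueE /bellman Er Eh.
  have -> : can_roll (swap s') = can_roll s' by rewrite /can_roll /need /=; case: (mover s').
  have -> : can_hold (swap s') = can_hold s' by [].
  case: ifP => // _; case: ifP => // _.
  have -> : mover (swap s') = ~~ mover s' by [].
  case: (mover s') => /=; case: leP => le1; case: leP => le2; lra.
have [d dP] := greedy_exists game_value; have [d' dP'] := greedy_exists u.
have := @lower_value_eq R n p die_p N _ d (fun s _ => game_value_bounds s)
  (fun s _ => game_valueE s) (fun s sN => dP s (is_state_rh sN)) s sN.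
rewrite (@lower_value_eq R n p die_p N _ d' (fun s _ => u01 s)
  (fun s _ => u_fix s) (fun s sN => dP' s (is_state_rh sN)) s sN) => <-.
by rewrite /u; ring.
Qed.

End Value.

(** * Crossings of convex functions and of their linear pieces *)

Section Switching.
Variable R : realFieldType.
Implicit Types (F L : R -> R) (y z : R).

(** The strict upper bound is what makes crossings unique; for the functions of the game it comes
    from [p ord0 < 1]. *)
Definition contractive F : Prop :=
  forall y z, y < z -> 0 <= F z - F y < z - y.

Lemma contractive_le F y z : contractive F -> y <= z -> 0 <= F z - F y <= z - y.
Proof.
move=> cF; rewrite le_eqVlt => /orP[/eqP->|/cF /andP[-> /ltW->] //].
by rewrite !subrr lexx.
Qed.

(** Passing through [F] strictly shortens the distance between two distinct crossings and passing
    through [F'] does not lengthen it, yet together they lead back to the same two points. *)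
Lemma crossing_unique F F' y y' z z' : contractive F -> contractive F' ->
  y = 1 - F' y' -> y' = 1 - F y -> z = 1 - F' z' -> z' = 1 - F z -> y = z.
Proof.
move=> cF cF' ey ey' ez ez'.
suff le_sol u u' v v' : u = 1 - F' u' -> u' = 1 - F u ->
    v = 1 - F' v' -> v' = 1 - F v -> u <= v.
  by apply/eqP; rewrite eq_le (le_sol _ _ _ _ ey ey' ez ez') (le_sol _ _ _ _ ez ez' ey ey').
move=> eu eu' ev ev'; rewrite leNgt; apply/negP => lt_vu.
have /andP[] := cF _ _ lt_vu.
have [le_uv'|] := leP u' v'; last lra.
by have /andP[] := contractive_le cF' le_uv'; lra.
Qed.

(* The crossing of the lines [L] and [L'], which lie below [F] and [F'], may be on
   either side of the crossing of [F] and [F'], yet a crossing of the lines below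
   a contact point of [L] and [F] is conclusive. *)
Lemma crossing_lt F F' L L' th y y' z z' :
    contractive F -> contractive F' -> contractive L -> contractive L' ->
    y = 1 - F' y' -> y' = 1 - F y -> z = 1 - L' z' -> z' = 1 - L z ->
    (forall x, L' x <= F' x) -> F th = L th ->
  z < th -> y < th.
Proof.
move=> cF cF' cL cL' ey ey' ez ez' le_LF eth lt_zth.
rewrite ltNge; apply/negP => le_thy.
have /andP[F0 F1] := contractive_le cF le_thy.
have /andP[L0 L1] := cL _ _ lt_zth.
have le1 : y' <= 1 - F th by lra.
have /andP[_ H1] := contractive_le cF' le1.
have le2 : 1 - F th <= z' by rewrite eth; lra.
have /andP[_ H2] := contractive_le cL' le2.
(* At the point [1 - F th], [H2] puts [L'] above [1 - th], while [H1] keeps [F'] at or below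
   [1 - th]. *)
have H3 := le_LF (1 - F th); rewrite eth in H1 H2 H3 F0 F1 *; lra.
Qed.

(** The lines cannot cross beyond the interval on which they are exact. Otherwise [1 - F top] would
    lie between [z'] and [y'], where [F'] and [L'] agree, and comparison with the two crossings
    would put [1 - F' (1 - F top)] both at most [top] and above it. *)
Lemma crossing_le F F' L L' th' top top' y y' z z' :
    contractive F -> contractive F' -> contractive L -> contractive L' ->
    y = 1 - F' y' -> y' = 1 - F y -> z = 1 - L' z' -> z' = 1 - L z ->
    F top = L top -> (forall x, th' <= x <= top' -> F' x = L' x) ->
    y <= top -> y' <= top' -> th' <= z' ->
  z <= top.
Proof.
move=> cF cF' cL cL' ey ey' ez ez' etop e' y_top y_top' th_z.
rewrite leNgt; apply/negP => lt_topz.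
have /andP[L0 L1] := cL _ _ lt_topz.
have /andP[F0 F1] := contractive_le cF y_top.
have le1 : 1 - F top <= y' by lra.
have le2 : z' <= 1 - F top by rewrite etop; lra.
have /andP[_ H1] := contractive_le cF' le1.
have /andP[_ H2] := contractive_le cL' le2.
have H3 : F' (1 - F top) = L' (1 - F top) by apply: e'; apply/andP; split; lra.
rewrite etop in H1 H2 H3 F0 F1 *; lra.
Qed.

(** [crossing_le], used in both directions, places the crossing of the lines where they coincide
    with the functions; uniqueness does the rest. *)
Lemma crossing_eq F F' L L' th th' top top' y y' z z' :
    contractive F -> contractive F' -> contractive L -> contractive L' ->
    y = 1 - F' y' -> y' = 1 - F y -> z = 1 - L' z' -> z' = 1 - L z ->
    (forall x, th <= x <= top -> F x = L x) ->
    (forall x, th' <= x <= top' -> F' x = L' x) ->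
    F top = L top -> F' top' = L' top' ->
    y <= top -> y' <= top' -> th <= z -> th' <= z' ->
  y = z /\ y' = z'.
Proof.
move=> cF cF' cL cL' ey ey' ez ez' e e' et et' le_y le_y' le_z le_z'.
have z_top : z <= top.
  exact: (crossing_le cF cF' cL cL' ey ey' ez ez' et e' le_y le_y' le_z').
have z_top' : z' <= top'.
  exact: (crossing_le cF' cF cL' cL ey' ey ez' ez et' e le_y' le_y le_z).
have fz : z' = 1 - F z by rewrite e ?le_z.
have fz' : z = 1 - F' z' by rewrite e' ?le_z'.
have eyz := crossing_unique cF cF' ey ey' fz' fz.
by split=> //; rewrite ey' fz eyz.
Qed.

End Switching.

(** * The recursion for a single turn *)

Section Recursion.
Variables (R : realFieldType) (n : nat) (q : nat -> R).
Hypothesis q_ge0 : forall i, 0 <= q i.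
Hypothesis q_sum : \sum_(i < n.+1) q i = 1.
Hypothesis q0_lt1 : q 0 < 1.
Implicit Types (D : nat -> R -> R) (c : nat -> R) (h : nat -> bool).

(** The values for the needs [k], ..., 1 in this order, which makes a course-of-values recursion
    structural. Looking past the end means that no points are missing: the default 1 is a game
    won. *)
Fixpoint after_table D y k : seq R :=
  if k is k'.+1 then
    let s := after_table D y k' in
    D k (q 0 * y + \sum_(i < n) q i.+1 * nth 1 s i) :: s
  else [::].

(* Winning probability of the player on turn when holding would leave him in need
   of [r] points, a zero is worth [y], and [D r x] is what he gets after a decision
   with roll value [x]; truncated subtraction puts all [r <= 0] at [r = 0]. *)
Definition after D y r : R := head 1 (after_table D y r).

Definition roll D y r : R :=
  q 0 * y + \sum_(i < n) q i.+1 * after D y (r - i.+1).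

Lemma nth_after_table D y k i : nth 1 (after_table D y k) i = after D y (k - i).
Proof. by elim: k i => [|k IHk] [|i] //=; rewrite ?subSS ?IHk. Qed.

Lemma after0 D y : after D y 0 = 1. Proof. by []. Qed.

Lemma afterS D y r : (0 < r)%N -> after D y r = D r (roll D y r).
Proof.
case: r => // r _; congr (D _ (_ + _)); apply: eq_bigr => i _.
by rewrite nth_after_table.
Qed.

Lemma roll_ext D D' y y' a : (0 < a)%N -> q 0 * y = q 0 * y' ->
  (forall r, (r < a)%N -> after D y r = after D' y' r) ->
  roll D y a = roll D' y' a.
Proof.
move=> a0 eq0 eqa; rewrite /roll eq0; congr (_ + _); apply: eq_bigr => i _.
by rewrite eqa //; case: a a0 {eqa} => // a _; rewrite subSS ltnS leq_subr.
Qed.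

(** Weaker than [contractive], since a decision to roll passes its argument on unchanged; strictness
    is gained in the roll itself. *)
Definition nonexpansive D : Prop :=
  forall k (x z : R), x <= z -> 0 <= D k z - D k x <= z - x.

Let q_sumS : q 0 + \sum_(i < n) q i.+1 = 1.
Proof. by rewrite -q_sum big_ord_recl. Qed.

(** A zero passes on the full distance [z - y], so strictness needs a nonzero face of positive
    probability, which exists since [q 0 < 1]. The case [s == 0] of the hypothesis serves [r = 0],
    where truncated subtraction stays at 0. *)
Lemma roll_contract_aux D y z r : y < z -> nonexpansive D ->
  (forall s, (s < r)%N || (s == 0)%N -> 0 <= after D z s - after D y s < z - y) ->
  0 <= roll D z r - roll D y r < z - y.
Proof.
move=> yz nD IH.
have -> : roll D z r - roll D y r =
    q 0 * (z - y) + \sum_(i < n) q i.+1 * (after D z (r - i.+1) - after D y (r - i.+1)).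
  rewrite /roll opprD addrACA -mulrBr; congr (_ + _).
  by rewrite -sumrB; apply: eq_bigr => i _; rewrite mulrBr.
have IHi i : 0 <= after D z (r - i.+1) - after D y (r - i.+1) < z - y.
  by apply: IH; case: r => [|r]; rewrite ?eqxx ?orbT // subSS ltnS leq_subr.
have d0 : 0 <= z - y by rewrite subr_ge0 ltW.
apply/andP; split.
  apply: addr_ge0; first exact: mulr_ge0.
  by apply: sumr_ge0 => i _; apply: mulr_ge0 => //; case/andP: (IHi i).
rewrite -[ltRHS]mul1r -q_sumS mulrDl ltrD2l mulr_suml.
have [/existsP[i0 qi0]|/existsPn q0] := boolP [exists i : 'I_n, 0 < q i.+1].
  rewrite (bigD1 i0) //= [ltRHS](bigD1 i0) //=; apply: ltr_leD.
    by rewrite ltr_pM2l //; case/andP: (IHi i0).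
  by apply: ler_sum => i _; apply: ler_wpM2l => //; case/andP: (IHi i) => _ /ltW.
move: q0_lt1; rewrite -q_sumS ltrDl big1 ?ltxx // => i _.
by apply/eqP; have := q0 i; rewrite lt_neqAle q_ge0 andbT negbK eq_sym.
Qed.

Lemma after_contractive D y z r : nonexpansive D -> y < z ->
  0 <= after D z r - after D y r < z - y.
Proof.
move=> nD yz; elim/ltn_ind: r => -[|r] IH; first by rewrite !after0 subrr lexx subr_gt0.
rewrite !afterS //.
have /andP[r0 r1] : 0 <= roll D z r.+1 - roll D y r.+1 < z - y.
  by apply: roll_contract_aux => // s /orP[/IH //|/eqP ->]; apply: IH.
have yz_le : roll D y r.+1 <= roll D z r.+1 by rewrite -subr_ge0.
by have /andP[-> d1] := nD r.+1 _ _ yz_le; apply: le_lt_trans d1 r1.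
Qed.

Lemma roll_contractive D r : nonexpansive D -> contractive (fun y => roll D y r).
Proof.
by move=> nD y z yz; apply: roll_contract_aux => // s _; apply: after_contractive.
Qed.

Lemma roll_mono D r y z : nonexpansive D -> y <= z -> roll D y r <= roll D z r.
Proof.
move=> nD yz; rewrite -subr_ge0.
by have /andP[] := contractive_le (@roll_contractive D r nD) yz.
Qed.

Definition best c k (x : R) : R := Num.max (c k) x.

Definition follow h c k (x : R) : R := if h k then c k else x.

Lemma best_nonexpansive c : nonexpansive (best c).
Proof.
move=> k x z xz; rewrite /best; case: (leP (c k) z) => H1; case: (leP (c k) x) => H2;
  by apply/andP; split; lra.
Qed.

Lemma follow_nonexpansive h c : nonexpansive (follow h c).
Proof.
by move=> k x z xz; rewrite /follow; case: (h k); rewrite ?subrr ?lexx ?subr_ge0 ?xz.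
Qed.

Lemma follow_le_best h c y r : after (follow h c) y r <= after (best c) y r.
Proof.
elim/ltn_ind: r => -[//|r] IH; rewrite !afterS // /follow /best.
case: (h r.+1); first by rewrite le_max lexx.
rewrite le_max; apply/orP; right; rewrite /roll lerD2l; apply: ler_sum => i _.
by apply: ler_wpM2l => //; apply: IH; rewrite subSS ltnS leq_subr.
Qed.

Lemma roll_follow_le_best h c y r : roll (follow h c) y r <= roll (best c) y r.
Proof.
rewrite /roll lerD2l; apply: ler_sum => i _; apply: ler_wpM2l => //.
exact: follow_le_best.
Qed.

Definition slope h c r : R := roll (follow h c) 1 r - roll (follow h c) 0 r.

Lemma slope_ge0 h c r : 0 <= slope h c r.
Proof. by rewrite subr_ge0 roll_mono //; exact: follow_nonexpansive. Qed.

(** A hold is constant in [y], and a roll averages affine functions; so a piece is known from its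
    values at 0 and 1. *)
Lemma roll_affine h c y r :
  roll (follow h c) y r = roll (follow h c) 0 r + slope h c r * y.
Proof.
suff affine_after s : after (follow h c) y s = after (follow h c) 0 s +
    (after (follow h c) 1 s - after (follow h c) 0 s) * y.
  rewrite /slope /roll; under eq_bigr do rewrite affine_after mulrDr.
  rewrite big_split /=.
  under [X in _ + (_ + X)]eq_bigr do rewrite mulrA mulrBr.
  by rewrite -mulr_suml sumrB; ring.
elim/ltn_ind: s => -[|s] IH; first by rewrite !after0; ring.
rewrite !afterS // /follow; case: (h s.+1); first by ring.
rewrite /roll.
have {}IH (i : 'I_n) : after (follow h c) y (s.+1 - i.+1) = after (follow h c) 0 (s.+1 - i.+1) +
    (after (follow h c) 1 (s.+1 - i.+1) - after (follow h c) 0 (s.+1 - i.+1)) * y.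
  by apply: IH; rewrite subSS ltnS leq_subr.
under eq_bigr do rewrite IH mulrDr.
rewrite big_split /=.
under [X in _ + (_ + X)]eq_bigr do rewrite mulrA mulrBr.
by rewrite -mulr_suml sumrB; ring.
Qed.

(* The decisions [h] at [0 < r < a] are optimal if a zero is worth [y]. *)
Definition follow_optimal h c a y : Prop :=
  forall r, (0 < r < a)%N ->
    if h r then roll (follow h c) y r <= c r else c r <= roll (follow h c) y r.

Lemma follow_optimal_after h c a y r : follow_optimal h c a y -> (r < a)%N ->
  after (follow h c) y r = after (best c) y r.
Proof.
move=> opt; elim/ltn_ind: r => -[//|r] IH ra; rewrite !afterS //.
rewrite -(@roll_ext (follow h c) (best c) y y r.+1) //; last first.
  by move=> s sr; apply: IH => //; apply: ltn_trans ra.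
have := opt r.+1 ra; rewrite {1 3}/follow /best; case: (h r.+1) => le_rc.
  by rewrite max_l.
by rewrite max_r.
Qed.

Lemma follow_optimal_roll h c a y r : follow_optimal h c a y -> (0 < r <= a)%N ->
  roll (follow h c) y r = roll (best c) y r.
Proof.
move=> opt /andP[r0 ra]; apply: roll_ext => // s sr.
by apply: follow_optimal_after opt _; apply: leq_trans ra.
Qed.

(* Holding at [r] is better than rolling for [y] below [break h c r], provided that
   the slope is positive; a zero slope gives the harmless value [0]. *)
Definition break h c r : R := (c r - roll (follow h c) 0 r) / slope h c r.

(** The left end [th] of the current piece, cut off at 0 because a zero is worth a probability,
    together with a roll [k] that has to be revised below it. *)
Definition last_break h c a th k : Prop :=
  [/\ 0 <= th,
      forall r, (0 < r < a)%N -> ~~ h r -> break h c r <= th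
    & th = 0 \/ [/\ (0 < k < a)%N, ~~ h k & th = break h c k]].

(** Lowering [y] lowers roll values only, so holds stay optimal; a roll stays optimal down to its
    break, or forever if its slope is 0. *)
Lemma follow_optimal_between h c a th k top y :
    follow_optimal h c a top -> last_break h c a th k -> th <= y <= top ->
  follow_optimal h c a y.
Proof.
move=> opt [_ th_max _] /andP[th_y y_top] r ra; move: (opt r ra) (th_max r ra).
case: (h r) => [le_rc _|le_cr /(_ isT) le_bth].
  by apply: le_trans le_rc; apply: roll_mono => //; exact: follow_nonexpansive.
have [s0|s0] := eqVneq (slope h c r) 0.
  by move: le_cr; rewrite (roll_affine h c top) (roll_affine h c y) s0 !mul0r.
have sp : 0 < slope h c r by rewrite lt_neqAle eq_sym s0 slope_ge0.
have : break h c r <= y by apply: le_trans th_y.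
by rewrite (roll_affine h c y) ler_pdivrMr // => H; rewrite addrC -lerBlDr mulrC.
Qed.

Lemma last_break_le_top h c a th k top : follow_optimal h c a top -> 0 <= top ->
  last_break h c a th k -> th <= top.
Proof.
move=> opt top0 [th0 _ [->//|[ka hk thE]]].
have [s0|s0] := eqVneq (slope h c k) 0; first by rewrite thE /break s0 invr0 mulr0.
have sp : 0 < slope h c k by rewrite lt_neqAle eq_sym s0 slope_ge0.
rewrite thE ler_pdivrMr // lerBlDr addrC mulrC -roll_affine.
by have := opt k ka; rewrite (negPf hk).
Qed.

(** At its own break the roll at [k] is worth exactly [c k], so turning it into a hold changes no
    value at [y = th]. Positivity of [th] excludes the cut-off at 0 and a zero slope. *)
Lemma follow_optimal_flip h c a th k :
    follow_optimal h c a th -> last_break h c a th k -> 0 < th ->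
  [/\ (0 < k < a)%N, ~~ h k
    & follow_optimal (fun r => (r == k) || h r) c a th].
Proof.
move=> opt [_ _ [->|[ka hk thE]] th_gt0]; first by rewrite ltxx in th_gt0.
split=> //.
have rk : roll (follow h c) th k = c k.
  have s0 : slope h c k != 0.
    by apply: contraTneq th_gt0 => s0; rewrite thE /break s0 invr0 mulr0 ltxx.
  by rewrite roll_affine thE /break mulrC divfK // addrC subrK.
set h' := fun r => _.
have eq_after r : after (follow h' c) th r = after (follow h c) th r.
  elim/ltn_ind: r => -[//|r] IH; rewrite !afterS //.
  rewrite (@roll_ext _ (follow h c) th th r.+1) //.
  rewrite /follow /h'; case: eqP => //= ->; rewrite (negPf hk) rk //.
have eq_roll r : roll (follow h' c) th r = roll (follow h c) th r.
  by rewrite /roll; congr (_ + _); apply: eq_bigr => i _; rewrite eq_after.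
move=> r ra; rewrite eq_roll /h'; case: eqP => [->|_] /=; first by rewrite rk.
exact: opt.
Qed.

End Recursion.

(** * The values of the turn starts *)

Section PigValue.
Variables (R : realType) (n : nat) (p : 'I_n.+1 -> R).
Hypothesis die_p : is_die p.

Definition face_prob (i : nat) : R := oapp p 0 (insub i).

Lemma face_probE (i : 'I_n.+1) : face_prob i = p i.
Proof. by rewrite /face_prob valK. Qed.

Lemma face_prob_ge0 i : 0 <= face_prob i.
Proof. by rewrite /face_prob; case: insub => //= j; case: die_p. Qed.

Lemma face_prob_sum : \sum_(i < n.+1) face_prob i = 1.
Proof. by under eq_bigr do rewrite face_probE; case: die_p. Qed.

Lemma face_prob0_lt1 : face_prob 0 < 1.
Proof. by rewrite (face_probE ord0); case: die_p. Qed.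

(* By symmetry, [turn_value a b] is the winning probability of either player when
   he starts a turn in need of [a] points against an opponent in need of [b]. *)
Definition turn_value (a b : nat) : R := game_value p (State a b 0 true).

(** The worth of handing over the turn in need of [r] points to an opponent in need of [b]: the
    payoff of holding and, with [r] the need at the start of the turn, the value [y] of a zero. *)
Definition bank (b r : nat) : R := 1 - turn_value b r.

Local Notation gv := (game_value p).
Local Notation proll := (roll n face_prob).
Local Notation pafter := (after n face_prob).

Lemma turn_value_bounds a b : 0 <= turn_value a b <= 1.
Proof. exact: game_value_bounds. Qed.

Lemma bank_bounds a b : 0 <= bank a b <= 1.
Proof. by have /andP[] := turn_value_bounds a b; rewrite /bank => *; apply/andP; split; lra. Qed.

Lemma game_value_false a b t : (0 < a)%N -> (0 < b)%N -> (t < b + n)%N ->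
  gv (State a b t false) = 1 - gv (State b a t true).
Proof.
move=> a0 b0 tb; have := @game_value_swap R n p die_p (maxn a b) (State b a t true).
by move=> <- //; rewrite /is_state /need /=; lia.
Qed.

Lemma roll_value_split (u : state -> R) s : roll_value p u s =
  face_prob 0 * u (after_roll s 0) + \sum_(i < n) face_prob i.+1 * u (after_roll s i.+1).
Proof.
rewrite /roll_value big_ord_recl /= (face_probE ord0); congr (_ + _).
by apply: eq_bigr => i _; rewrite -(face_probE (lift ord0 i)).
Qed.

Lemma game_value_after a b t : (0 < a)%N -> (0 < b)%N -> (0 < t)%N ->
  gv (State a b t true) = pafter (best (bank b)) (bank b a) (a - t).
Proof.
move=> a0 b0; move: {2}(a - t)%N (leqnn (a - t)) => k; elim: k t => [|k IHk] t le_k t0.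
  have -> : (a - t = 0)%N by apply/eqP; rewrite -leqn0.
  rewrite game_valueE // /bellman /can_roll /need /= -subn_gt0 ltnNge le_k /=.
  by rewrite /hold_value /need /= -subn_eq0 -leqn0 le_k.
have [at_|ta] := leqP a t.
  have -> : (a - t = 0)%N by apply/eqP; rewrite subn_eq0.
  rewrite game_valueE // /bellman /can_roll /need /= ltnNge at_ /=.
  by rewrite /hold_value /need /= at_.
rewrite afterS ?subn_gt0 // game_valueE // /bellman /can_roll /can_hold /need /= ta t0 /=.
rewrite maxC /best; congr (Num.max _ _).
  by rewrite /hold_value /need /= leqNgt ta /= game_value_false //; lia.
rewrite roll_value_split /roll /= game_value_false ?addn_gt0 ?a0 ?b0 //; congr (_ + _).
apply: eq_bigr => i _; rewrite IHk ?addn_gt0 ?t0 //; first by rewrite subnDA.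
by move: le_k; lia.
Qed.

Lemma roll_value_true a b t : (0 < a)%N -> (0 < b)%N -> (t < a)%N ->
  roll_value p gv (State a b t true) = proll (best (bank b)) (bank b a) (a - t).
Proof.
move=> a0 b0 ta; rewrite roll_value_split /roll /= game_value_false ?addn_gt0 ?a0 ?b0 //.
congr (_ + _); apply: eq_bigr => i _.
by rewrite game_value_after ?addn_gt0 ?orbT // subnDA.
Qed.

Lemma turn_valueE a b : (0 < a)%N -> (0 < b)%N ->
  turn_value a b = proll (best (bank b)) (bank b a) a.
Proof.
move=> a0 b0; rewrite /turn_value game_valueE // /bellman /can_roll /need /= a0 /=.
by rewrite roll_value_true // subn0.
Qed.

Lemma hold_value_true a b t : (0 < a)%N -> (0 < b)%N -> (t < a)%N ->
  hold_value gv (State a b t true) = bank b (a - t).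
Proof.
move=> a0 b0 ta; rewrite /hold_value /need /= leqNgt ta /=.
by rewrite game_value_false //; lia.
Qed.

Lemma roll_value_false a b t : (0 < a)%N -> (0 < b)%N -> (t < a)%N ->
  roll_value p gv (State b a t false) = 1 - proll (best (bank b)) (bank b a) (a - t).
Proof.
move=> a0 b0 ta; rewrite -roll_value_true //.
have := roll_valueB p (fun=> 1) gv (State a b t true); rewrite (roll_value1 die_p) => <-.
apply: eq_bigr => i _ /=; case: ifP => _.
  rewrite game_value_false ?addn_gt0 ?a0 ?b0 //.
  by rewrite opprB addrC subrK.
by rewrite game_value_false //; have := ltn_ord i; lia.
Qed.

Lemma hold_value_false a b t : (0 < a)%N -> (0 < b)%N -> (t < a)%N ->
  hold_value gv (State b a t false) = 1 - bank b (a - t).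
Proof.
move=> a0 b0 ta; rewrite /hold_value /need /= leqNgt ta /=.
by rewrite /bank opprB addrC subrK.
Qed.

Lemma bank_anti b r s : (r <= s)%N -> bank b s <= bank b r.
Proof. by move=> rs; rewrite lerB // game_value_need2. Qed.

(* Rolling is at least as good as passing since after any roll one may bank a
   positive turn score. *)
Lemma bank_le_turn_value a b : (0 < a)%N -> (0 < b)%N -> bank b a <= turn_value a b.
Proof.
move=> a0 b0; rewrite turn_valueE // /roll.
rewrite -[leLHS]mul1r -face_prob_sum big_ord_recl mulrDl lerD2l mulr_suml.
apply: ler_sum => i _; apply: ler_wpM2l; first exact: face_prob_ge0.
have [->|r0] := posnP (a - i.+1); first by have /andP[] := bank_bounds b a.
rewrite afterS // /best le_max; apply/orP; left.
by apply: bank_anti; rewrite leq_subr.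
Qed.

(** By symmetry one predicate serves both players; [a + n] is the bound on turn scores in
    [is_state]. *)
Definition good_actions (act : nat -> bool) (a b : nat) : Prop :=
  [/\ act 0%N, forall t, (a <= t < a + n)%N -> ~~ act t
    & forall t, (0 < t < a)%N ->
      if act t then bank b (a - t) <= proll (best (bank b)) (bank b a) (a - t)
      else proll (best (bank b)) (bank b a) (a - t) <= bank b (a - t)].

Lemma good_actions_greedy N (d : state -> bool) :
    (forall a b, (0 < a <= N)%N -> (0 < b <= N)%N ->
      good_actions (fun t => d (State a b t true)) a b /\
      good_actions (fun t => d (State b a t false)) a b) ->
  forall s, is_state n N s -> greedy p d gv s.
Proof.
move=> good [a b t []]; rewrite /is_state /greedy /can_roll /can_hold /need /=.
  case/and3P=> aN bN ta; have [[g0 ga gt] _] := good _ _ aN bN.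
  have a0 : (0 < a)%N by case/andP: aN.
  have b0 : (0 < b)%N by case/andP: bN.
  split.
  - by rewrite -eqn0Ngt => /eqP ->.
  - by rewrite -leqNgt => at_; apply: ga; rewrite at_ /=; lia.
  - move=> lt_ta t0; rewrite roll_value_true // hold_value_true //.
    by move: (gt t); rewrite t0 lt_ta => /(_ isT); case: (d _).
case/and3P=> aN bN ta; have [_ [g0 ga gt]] := good _ _ bN aN.
have a0 : (0 < a)%N by case/andP: aN.
have b0 : (0 < b)%N by case/andP: bN.
split.
- by rewrite -eqn0Ngt => /eqP ->.
- by rewrite -leqNgt => at_; apply: ga; rewrite at_ /=; lia.
- move=> lt_ta t0; rewrite roll_value_false // hold_value_false //.
  by move: (gt t); rewrite t0 lt_ta => /(_ isT); case: (d _) => /= le; rewrite lerB.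
Qed.

End PigValue.

(** * Total correctness with time bounds *)

Section Runs.
Variable R : realType.
Implicit Types (c : program) (m : memory R) (Q : memory R -> Prop).

(** With a bound in place of the exact time, the rules below can be chained with [T] left to
    unification, and the arithmetic is settled once at the end. *)
Definition runs c m (T : nat) Q : Prop :=
  exists m' t, [/\ exec c m m' t, (t <= T)%N & Q m'].

Lemma runs_weaken c m T T' Q Q' :
  runs c m T Q -> (T <= T')%N -> (forall m', Q m' -> Q' m') -> runs c m T' Q'.
Proof.
move=> [m' [t [ex tT Qm]]] TT QQ; exists m', t; split=> //; last exact: QQ.
exact: leq_trans TT.
Qed.

Lemma runs_le c m T T' Q : runs c m T Q -> (T <= T')%N -> runs c m T' Q.
Proof. by move=> H le; apply: runs_weaken H le _. Qed.

Lemma runs_skip m Q : Q m -> runs Skip m 1 Q.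
Proof. by move=> Qm; exists m, 1%N; split=> //; exact: exec_skip. Qed.

Lemma runs_nstore m x i e Q :
    Q (Memory (upd (nats m) x (neval m i) (neval m e)) (reals m)) ->
  runs (NStore x i e) m (ncost i + ncost e).+1 Q.
Proof. by move=> Qm; do 2!eexists; split; [exact: exec_nstore|exact: leqnn|]. Qed.

Lemma runs_rstore m x i e Q :
    Q (Memory (nats m) (upd (reals m) x (neval m i) (reval m e))) ->
  runs (RStore x i e) m (ncost i + rcost e).+1 Q.
Proof. by move=> Qm; do 2!eexists; split; [exact: exec_rstore|exact: leqnn|]. Qed.

Lemma runs_seq c1 c2 m T1 T2 Q :
  runs c1 m T1 (fun m' => runs c2 m' T2 Q) -> runs (Seq c1 c2) m (T1 + T2) Q.
Proof.
move=> [m1 [t1 [ex1 tT1 [m2 [t2 [ex2 tT2 Qm]]]]]].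
exists m2, (t1 + t2)%N; split=> //; first exact: exec_seq ex1 ex2.
exact: leq_add.
Qed.

(** Adding the times of the branches at most doubles their maximum and keeps bounds linear. *)
Lemma runs_if b c1 c2 m T1 T2 Q :
    (teval m b -> runs c1 m T1 Q) -> (~~ teval m b -> runs c2 m T2 Q) ->
  runs (If b c1 c2) m (tcost b + (T1 + T2)) Q.
Proof.
move=> H1 H2; have [tb|ntb] := boolP (teval m b).
  have [m' [t [ex tT Qm]]] := H1 tb; exists m', (tcost b + t)%N; split=> //.
    exact: exec_if_true.
  by rewrite leq_add2l (leq_trans tT) ?leq_addr.
have [m' [t [ex tT Qm]]] := H2 ntb; exists m', (tcost b + t)%N; split=> //.
  exact: exec_if_false.
by rewrite leq_add2l (leq_trans tT) ?leq_addl.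
Qed.

Lemma runs_while b c (I : memory R -> Prop) (mu : memory R -> nat) T m :
    (forall m', I m' -> teval m' b ->
       runs c m' T (fun m'' => I m'' /\ (mu m'' < mu m')%N)) ->
    I m ->
  runs (While b c) m (mu m * (tcost b + T) + tcost b) (fun m' => I m' /\ ~~ teval m' b).
Proof.
move=> step; move: {2}(mu m) (leqnn (mu m)) => k; elim: k m => [|k IHk] m le_mk Im.
  have [tb|ntb] := boolP (teval m b).
    have [m' [t [_ _ [_]]]] := step m Im tb.
    by move=> /leq_trans/(_ le_mk); rewrite ltn0.
  by exists m, (tcost b); split=> //; [exact: exec_while_false|exact: leq_addl].
have [tb|ntb] := boolP (teval m b); last first.
  by exists m, (tcost b); split=> //; [exact: exec_while_false|exact: leq_addl].
have [m1 [t1 [ex1 tT1 [Im1 lt_mu]]]] := step m Im tb.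
have [|m2 [t2 [ex2 tT2 Qm]]] := IHk m1 _ Im1; first by rewrite -ltnS (leq_trans lt_mu).
exists m2, (tcost b + t1 + t2)%N; split=> //; first exact: exec_while_true ex1 ex2.
apply: leq_trans (leq_add (leq_add (leqnn (tcost b)) tT1) tT2) _.
by rewrite addnA leq_add2r -mulSn leq_mul2r lt_mu orbT.
Qed.

Definition scal x := NLoad x (NLit 0).
Definition rscal x := RLoad x (NLit 0).

Definition For (x : nat) (e : nexp) c : program :=
  While (NLe (scal x) e) (Seq c (NStore x (NLit 0) (NAdd (scal x) (NLit 1)))).

Lemma runs_for x e c (J : nat -> memory R -> Prop) lo hi T m :
    (forall j m', J j m' -> nats m' x 0 = j /\ neval m' e = hi) ->
    (forall j m', (lo <= j <= hi)%N -> J j m' ->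
       runs c m' T (fun m'' => nats m'' x 0 = j /\
         J j.+1 (Memory (upd (nats m'') x 0 j.+1) (reals m'')))) ->
    (lo <= hi.+1)%N -> J lo m ->
  runs (For x e c) m ((hi.+1 - lo) * (ncost e + T + 10) + (ncost e + 10)) (J hi.+1).
Proof.
move=> JP step le_lo Jm.
pose I m' := exists j, [/\ (lo <= j <= hi.+1)%N & J j m'].
pose mu m' := (hi.+1 - nats m' x 0)%N.
have [j_lo _] := JP _ _ Jm.
have := @runs_while (NLe (scal x) e)
  (Seq c (NStore x (NLit 0) (NAdd (scal x) (NLit 1)))) I mu (T + 6)%N m.
have Im : I m by exists lo; rewrite leqnn.
rewrite /mu j_lo => H; apply: runs_weaken (H _ Im) _ _.
- move=> m' [j [lohi Jj]] /=; have [-> ->] := JP _ _ Jj => le_jhi.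
  apply: runs_seq; have [|m'' [t [ex tT [xj Jj']]]] := step j m' _ Jj.
    by rewrite le_jhi andbT; case/andP: lohi.
  exists m'', t; split=> //; apply: runs_nstore => /=; rewrite xj addn1; split.
    by exists j.+1; split=> //; case/andP: lohi => lj _; rewrite (leq_trans lj).
  by rewrite /upd !eqxx /=; lia.
- by rewrite /= leq_add //; [rewrite leq_mul //|]; lia.
- move=> m' [[j [lohi Jj]]] /=; have [-> ->] := JP _ _ Jj => nle.
  by have <- : j = hi.+1 by lia.
Qed.

End Runs.

(** * The program *)

(* Array numbers.  A nonzero entry of [nHold] at [(l, r)] is the decision to hold
   that leaves a need of [r] against an opponent in need of [l]; entry [(k, l)] of
   [rVal] is [turn_value k l]; [nA] and [nB] hold the current pair.  The arrays
   from 10 on are registers; [nLen] and [nOpp] are the arguments of [line_loop] and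
   [act_loop]. *)
Local Notation nIn := 0%N.
Local Notation nAct1 := 1%N.
Local Notation nAct2 := 2%N.
Local Notation nHold := 3%N.
Local Notation nA := 4%N.
Local Notation nB := 5%N.
Local Notation nLen := 10%N.
Local Notation nOpp := 11%N.
Local Notation nR := 12%N.
Local Notation nI := 13%N.
Local Notation nBreak := 14%N.
Local Notation nBreakA := 20%N.
Local Notation rFace := 0%N.
Local Notation rOut := 1%N.
Local Notation rVal := 2%N.
Local Notation rE0 := 10%N.
Local Notation rE1 := 11%N.
Local Notation rAcc0 := 12%N.
Local Notation rAcc1 := 13%N.
Local Notation rBreak := 14%N.
Local Notation rA0 := 20%N.
Local Notation rA1 := 21%N.
Local Notation rBreakA := 22%N.
Local Notation rY := 23%N.
Local Notation rZ := 24%N.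

Definition target := NLoad nIn (NLit 0).
Definition faces := NLoad nIn (NLit 1).
Definition cell (l r : nexp) := NAdd (NMul l (NAdd target (NLit 1))) r.

(* Affine functions of [y] are represented by their values at [0] and [1]. *)
Definition sum_loop : program :=
  For nI faces
    (Seq (RStore rAcc0 (NLit 0) (RAdd (rscal rAcc0)
            (RMul (RLoad rFace (scal nI)) (RLoad rE0 (NSub (scal nR) (scal nI))))))
         (RStore rAcc1 (NLit 0) (RAdd (rscal rAcc1)
            (RMul (RLoad rFace (scal nI)) (RLoad rE1 (NSub (scal nR) (scal nI))))))).

Definition bank_exp := RSub (RLit 1) (RLoad rVal (cell (scal nOpp) (scal nR))).

Definition break_exp :=
  RDiv (RSub bank_exp (rscal rAcc0)) (RSub (rscal rAcc1) (rscal rAcc0)).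

Definition line_body : program :=
  Seq (RStore rAcc0 (NLit 0) (RLit 0))
  (Seq (RStore rAcc1 (NLit 0) (RLoad rFace (NLit 0)))
  (Seq (NStore nI (NLit 0) (NLit 1))
  (Seq sum_loop
  (If (NLe (NLoad nHold (cell (scal nOpp) (scal nR))) (NLit 0))
    (Seq (RStore rE0 (scal nR) (rscal rAcc0))
    (Seq (RStore rE1 (scal nR) (rscal rAcc1))
      (If (TAnd (NLe (NAdd (scal nR) (NLit 1)) (scal nLen))
                (TNot (RLe break_exp (rscal rBreak))))
        (Seq (RStore rBreak (NLit 0) break_exp)
             (NStore nBreak (NLit 0) (scal nR)))
        Skip)))
    (Seq (RStore rE0 (scal nR) bank_exp)
         (RStore rE1 (scal nR) bank_exp)))))).

(** Evaluates the current piece at [y = 0] and [y = 1] and finds its last break. The final round,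
    with [nR] equal to [nLen], is the start of the turn: it leaves the roll value in [rE0] and
    [rE1], and since no decision is taken there it is kept out of the search for breaks. *)
Definition line_loop : program :=
  Seq (RStore rE0 (NLit 0) (RLit 1))
  (Seq (RStore rE1 (NLit 0) (RLit 1))
  (Seq (RStore rBreak (NLit 0) (RLit 0))
  (Seq (NStore nR (NLit 0) (NLit 1))
    (For nR (scal nLen) line_body)))).

(** * Correctness of the evaluation of a piece *)

Section LineLoop.
Variables (R : realType) (n N : nat) (q : nat -> R).
Implicit Types (m : memory R) (h : nat -> bool) (c : nat -> R).

(* The registers used by [line_loop] are the arrays 12, 13, 14 of naturals and
   the arrays 10 to 14 of reals. *)
Definition frame m m' : Prop :=
  (forall x i, ~~ (12 <= x < 15)%N -> nats m' x i = nats m x i) /\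
  (forall x i, ~~ (10 <= x < 15)%N -> reals m' x i = reals m x i).

Lemma frame_trans m1 m2 m3 : frame m1 m2 -> frame m2 m3 -> frame m1 m3.
Proof.
by move=> [n12 r12] [n23 r23]; split=> x i hx; rewrite ?n23 ?r23 ?n12 ?r12.
Qed.

Lemma frame_nstore m f g x i v : (12 <= x < 15)%N -> frame m (Memory f g) ->
  frame m (Memory (upd f x i v) g).
Proof.
move=> hx [fn fr]; split=> //= y j hy; rewrite /upd; case: eqP => [eyx|_] /=.
  by rewrite eyx hx in hy.
exact: fn.
Qed.

Lemma frame_rstore m f g x i v : (10 <= x < 15)%N -> frame m (Memory f g) ->
  frame m (Memory f (upd g x i v)).
Proof.
move=> hx [fn fr]; split=> //= y j hy; rewrite /upd; case: eqP => [eyx|_] /=.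
  by rewrite eyx hx in hy.
exact: fr.
Qed.

Definition inputs m : Prop :=
  [/\ nats m nIn 0 = N, nats m nIn 1 = n & forall i, reals m rFace i = q i].

Lemma inputs_frame m m' : frame m m' -> inputs m -> inputs m'.
Proof. by move=> [fn fr] [iN iin iq]; split=> [||i]; rewrite ?fn ?fr. Qed.

Lemma sum_loop_runs m r :
    inputs m -> nats m nR 0 = r -> nats m nI 0 = 1%N ->
  runs sum_loop m (n * 45 + 20) (fun m' =>
    [/\ frame m m', nats m' nR 0 = r, nats m' nBreak 0 = nats m nBreak 0,
        reals m' rBreak 0 = reals m rBreak 0
      & [/\ forall i, reals m' rE0 i = reals m rE0 i,
        forall i, reals m' rE1 i = reals m rE1 i,
        reals m' rAcc0 0 = reals m rAcc0 0 +
          \sum_(i < n) q i.+1 * reals m rE0 (r - i.+1)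
      & reals m' rAcc1 0 = reals m rAcc1 0 +
          \sum_(i < n) q i.+1 * reals m rE1 (r - i.+1)]]).
Proof.
move=> inm mr mi.
pose J j m' := nats m' nI 0 = j /\
    [/\ frame m m', nats m' nR 0 = r, nats m' nBreak 0 = nats m nBreak 0,
        reals m' rBreak 0 = reals m rBreak 0
      & [/\ forall i, reals m' rE0 i = reals m rE0 i,
        forall i, reals m' rE1 i = reals m rE1 i,
        reals m' rAcc0 0 = reals m rAcc0 0 +
          \sum_(i < j.-1) q i.+1 * reals m rE0 (r - i.+1)
      & reals m' rAcc1 0 = reals m rAcc1 0 +
          \sum_(i < j.-1) q i.+1 * reals m rE1 (r - i.+1)]].
have H := @runs_for R nI faces
    (Seq (RStore rAcc0 (NLit 0) (RAdd (rscal rAcc0)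
            (RMul (RLoad rFace (scal nI)) (RLoad rE0 (NSub (scal nR) (scal nI))))))
         (RStore rAcc1 (NLit 0) (RAdd (rscal rAcc1)
            (RMul (RLoad rFace (scal nI)) (RLoad rE1 (NSub (scal nR) (scal nI))))))) J 1 n.
apply: runs_weaken (H 30%N m _ _ _ _) _ _ => //.
- move=> j m' [m'i [fr _ _ _ _]]; split=> //.
  by have [_ <- _] := inputs_frame fr inm.
- move=> j m' /andP[j1 jn] [m'i [fr m'r m'k m't [m'0 m'1 a0 a1]]].
  eapply runs_le; first (apply: runs_seq; apply: runs_rstore; apply: runs_rstore).
  + split; first by rewrite /= /upd /=.
    have [_ _ iq] := inputs_frame fr inm.
    case: j j1 jn m'i a0 a1 => // j _ jn m'i a0 a1.
    split; first by rewrite /= /upd /=.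
    split=> //.
    * by apply: frame_nstore => //; do 2!apply: frame_rstore => //; exact: fr.
    * by split=> //=; rewrite /upd /= m'i m'r iq ?m'0 ?m'1 ?a0 ?a1 big_ord_recr /= addrA.
  + by [].
- split=> //; split=> //.
  by split=> //; rewrite big_ord0 addr0.
- by rewrite /=; lia.
- by move=> m' [_].
Qed.

Lemma line_loop_runs m l k h c :
    inputs m -> nats m nLen 0 = k -> nats m nOpp 0 = l ->
    (forall r, (0 < r <= k)%N -> h r = (nats m nHold (l * N.+1 + r) != 0)%N) ->
    (forall r, (0 < r < k)%N -> c r = 1 - reals m rVal (l * N.+1 + r)) ->
    (0 < k)%N -> ~~ h k ->
  runs line_loop m (k * (n * 45 + 300) + 300) (fun m' =>
    [/\ frame m m', reals m' rE0 k = roll n q (follow h c) 0 k,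
        reals m' rE1 k = roll n q (follow h c) 1 k
      & last_break n q h c k (reals m' rBreak 0) (nats m' nBreak 0)]).
Proof.
move=> inm mk ml mh mc k0 nhk.
(* [minn r k] because the last round, [r = k], contributes no break. *)
pose J r m' := nats m' nR 0 = r /\
  [/\ frame m m', forall s, (s < r)%N -> reals m' rE0 s = after n q (follow h c) 0 s,
      forall s, (s < r)%N -> reals m' rE1 s = after n q (follow h c) 1 s
    & last_break n q h c (minn r k) (reals m' rBreak 0) (nats m' nBreak 0)].
have kN x i : ~~ (12 <= x < 15)%N -> forall m', frame m m' -> nats m' x i = nats m x i.
  by move=> hx m' [fn _]; apply: fn.
have step r m' : (0 < r <= k)%N -> J r m' ->
    runs line_body m' (n * 45 + 200) (fun m'' => nats m'' nR 0 = r /\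
      J r.+1 (Memory (upd (nats m'') nR 0 r.+1) (reals m''))).
  move=> rk [m'r [fr e0 e1 lb]].
  have [iN iin iq] := inputs_frame fr inm.
  have m'l : nats m' nOpp 0 = l by rewrite (kN nOpp 0) //.
  have m'k : nats m' nLen 0 = k by rewrite (kN nLen 0) //.
  have m'h : (nats m' nHold (l * N.+1 + r) != 0)%N = h r by rewrite (kN nHold) // mh.
  rewrite /line_body; eapply runs_le.
    do 2!(apply: runs_seq; apply: runs_rstore).
    apply: runs_seq; apply: runs_nstore; apply: runs_seq.
    set m1 := Memory _ _.
    have fr1 : frame m m1.
      by apply: frame_nstore => //; do 2!apply: frame_rstore => //; exact: fr.
    have := @sum_loop_runs m1 r (inputs_frame fr1 inm) m'r erefl.
    move=> H; apply: (runs_weaken H (leqnn _)) => m2.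
    move=> [fr12 m2r m2k m2t [m20 m21 acc0 acc1]].
    have {}acc0 : reals m2 rAcc0 0 = roll n q (follow h c) 0 r.
      rewrite acc0 /m1 /= /upd /= /roll mulr0; congr (_ + _).
      apply: eq_bigr => i _; rewrite e0 //; lia.
    have {}acc1 : reals m2 rAcc1 0 = roll n q (follow h c) 1 r.
      rewrite acc1 /m1 /= /upd /= iq /roll mulr1; congr (_ + _).
      apply: eq_bigr => i _; rewrite e1 //; lia.
    have {m20}e0 s : (s < r)%N -> reals m2 rE0 s = after n q (follow h c) 0 s.
      by move=> sr; rewrite m20; exact: e0.
    have {m21}e1 s : (s < r)%N -> reals m2 rE1 s = after n q (follow h c) 1 s.
      by move=> sr; rewrite m21; exact: e1.
    have {m2t m2k}lb : last_break n q h c (minn r k) (reals m2 rBreak 0) (nats m2 nBreak 0).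
      by rewrite m2t m2k.
    have {fr12}fr2 : frame m m2 := frame_trans fr1 fr12.
    have [i2N _ _] := inputs_frame fr2 inm.
    have m2l : nats m2 nOpp 0 = l by rewrite (kN nOpp 0) //.
    have m2len : nats m2 nLen 0 = k by rewrite (kN nLen 0) //.
    have m2h : (nats m2 nHold (l * N.+1 + r) != 0)%N = h r by rewrite (kN nHold) // mh.
    have m2c : (r < k)%N -> 1 - reals m2 rVal (l * N.+1 + r) = c r.
      by move=> lt_rk; have [_ ->] := fr2; rewrite // mc // lt_rk andbT; case/andP: rk.
    have ES s : (s < r.+1)%N -> s = r \/ (s < r)%N.
      by rewrite ltnS leq_eqVlt => /orP[/eqP|]; [left|right].
    have r0 : (0 < r)%N by case/andP: rk.
    clearbody m1; clear m1 fr1 H.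
    apply: runs_if; rewrite /= i2N m2l m2r addn1 leqn0 => hr.
      have {}hr : ~~ h r by rewrite -m2h negbK.
      apply: runs_seq; apply: runs_rstore; apply: runs_seq; apply: runs_rstore => /=.
      rewrite m2r; set f1 := upd _ rE0 r _.
      have -> : f1 rAcc1 0%N = reals m2 rAcc1 0 by [].
      set f2 := upd _ rE1 r _.
      have fr3 : frame m (Memory (nats m2) f2) by do 2!apply: frame_rstore => //.
      have e02 s : (s < r.+1)%N -> f2 rE0 s = after n q (follow h c) 0 s.
        move=> /ES[->|sr]; rewrite /f2 /f1 /upd /=.
          by rewrite eqxx afterS // {1}/follow (negPf hr).
        by rewrite ltn_eqF //= e0.
      have e12 s : (s < r.+1)%N -> f2 rE1 s = after n q (follow h c) 1 s.
        move=> /ES[->|sr]; rewrite /f2 /f1 /upd /=.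
          by rewrite eqxx afterS // {1}/follow (negPf hr).
        by rewrite ltn_eqF //= e1.
      have brE : (r < k)%N -> (1 - f2 rVal (l * N.+1 + r)%N - f2 rAcc0 0%N) /
          (f2 rAcc1 0%N - f2 rAcc0 0%N) = break n q h c r.
        move=> lt_rk; rewrite /f2 /f1 /upd /= m2c // acc0 acc1 //.
      apply: runs_if; rewrite /= i2N m2l m2r m2len addn1.
        case/andP=> lt_rk; rewrite addn1 brE // -ltNge => lt_br.
        apply: runs_seq; apply: runs_rstore; apply: runs_nstore; split=> //=; split=> //.
        split; rewrite //= ?m2r.
        - by do 2!apply: frame_nstore => //; apply: frame_rstore.
        - move: lb => [t0 tmax _]; rewrite /upd /= i2N m2l addn1 ?m2r brE //.
          rewrite (minn_idPl lt_rk) (minn_idPl (ltnW lt_rk)) in tmax *.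
          split.
          + by apply: le_trans t0 (ltW lt_br).
          + move=> s /andP[s0 /ES[->//|sr]] hs.
            by apply: le_trans (ltW lt_br); apply: tmax => //; rewrite s0.
          + by right; rewrite r0 ltnS leqnn.
      rewrite negb_and => no_up; apply: runs_skip; split=> //; split=> //; split=> //=.
      - by apply: frame_nstore.
      - have [ge_rk|lt_rk] := leqP k r.
          rewrite (minn_idPr ge_rk) in lb.
          by rewrite (minn_idPr (leqW ge_rk)).
        move: no_up; rewrite lt_rk /= addn1 brE // negbK => le_br.
        move: lb => [t0 tmax tin].
        rewrite (minn_idPl lt_rk) (minn_idPl (ltnW lt_rk)) in tmax tin *.
        split=> //.
        + move=> s /andP[s0 /ES[->//|sr]] hs.
          by apply: tmax => //; rewrite s0.
        + case: tin => [t00|[/andP[b0 br] hb tE]]; [by left|right].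
          by rewrite b0 ltnS ltnW.
    have {}hr : h r by rewrite -m2h.
    have lt_rk : (r < k)%N.
      by rewrite ltn_neqAle; case/andP: rk => _ ->; rewrite andbT;
         apply: contraNneq nhk => <-.
    apply: runs_seq; apply: runs_rstore; apply: runs_rstore => /=.
    rewrite i2N m2l m2r addn1.
    have -> : upd (reals m2) rE0 r (1 - reals m2 rVal (l * N.+1 + r)) rVal (l * N.+1 + r) =
      reals m2 rVal (l * N.+1 + r) by [].
    rewrite m2c //; split=> //; split=> //; split=> /=.
    - apply: frame_nstore => //; apply: frame_rstore => //.
      exact: (@frame_rstore m _ (reals m2) rE0 r (c r) isT fr2).
    - move=> s /ES[->|sr]; rewrite /upd /=.
        by rewrite eqxx afterS // {1}/follow hr.
      by rewrite ltn_eqF //= e0.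
    - move=> s /ES[->|sr]; rewrite /upd /=.
        by rewrite eqxx afterS // {1}/follow hr.
      by rewrite ltn_eqF //= e1.
    - move: lb => [t0 tmax tin].
      rewrite (minn_idPl lt_rk) (minn_idPl (ltnW lt_rk)) in tmax tin *.
      split=> //.
      + move=> s /andP[s0 /ES[->|sr]] hs; first by rewrite hr in hs.
        by apply: tmax => //; rewrite s0.
      + case: tin => [t00|[/andP[b0 br] hb tE]]; [by left|right].
        by rewrite b0 ltnS ltnW.
  by rewrite /=; lia.
rewrite /line_loop; eapply runs_le.
  do 3!(apply: runs_seq; apply: runs_rstore); apply: runs_seq; apply: runs_nstore.
  set m1 := Memory _ _.
  have fr1 : frame m m1 by apply: frame_nstore => //; do 3!apply: frame_rstore => //.
  have := @runs_for R nR (scal nLen) line_body J 1 k (n * 45 + 200) m1.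
  move=> H; apply: (runs_weaken (H _ step _ _) (leqnn _)).
  - by move=> j m' [m'r [fr _ _ _]]; rewrite /= (kN nLen 0).
  - by [].
  - split=> //; split=> //.
    + by move=> [|s].
    + by move=> [|s].
    + split=> //; last by left.
      by move=> r; rewrite (minn_idPl k0); case: r => [|[]].
  - move=> m' [m'r [fr e0 e1 lb]]; split=> //.
    + by rewrite e0 // afterS // /follow (negPf nhk).
    + by rewrite e1 // afterS // /follow (negPf nhk).
    + by rewrite (minn_idPr (leqnSn k)) in lb.
by rewrite /= subn1 /=; nia.
Qed.

End LineLoop.

(** * Writing out the actions *)

Lemma pair_index_eq M x x' y y' : (y < M)%N -> (y' < M)%N ->
  (x * M + y == x' * M + y')%N = (x == x') && (y == y').
Proof.
move=> yM y'M; have M0 : (0 < M)%N by case: M yM {y'M}.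
apply/eqP/andP => [e|[/eqP-> /eqP->] //].
have := congr1 (divn^~ M) e; rewrite /= !divnMDl // !divn_small // !addn0 => ->.
by have := congr1 (modn^~ M) e; rewrite /= !modnMDl !modn_small // => ->.
Qed.

(* Truncated subtraction makes this nonzero exactly if the turn score is below the
   need and the entry of [nHold] is zero; the latter holds for turn score zero. *)
Definition act_exp :=
  NMul (NSub (scal nLen) (scal nR))
    (NSub (NLit 1) (NLoad nHold (cell (scal nOpp) (NSub (scal nLen) (scal nR))))).

Definition act_index (l r : nexp) :=
  NAdd (NMul (cell l r) (NAdd target faces)) (scal nR).

(** The same decisions serve both players; for player two the needs change places in the index. *)
Definition act_loop : program :=
  Seq (NStore nR (NLit 0) (NLit 0))
    (For nR (NSub (NAdd target faces) (NLit 1))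
      (Seq (NStore nAct1 (act_index (scal nLen) (scal nOpp)) act_exp)
           (NStore nAct2 (act_index (scal nOpp) (scal nLen)) act_exp))).

Section ActLoop.
Variables (R : realType) (n N : nat) (q : nat -> R).
Implicit Types m : memory R.

Definition act_cell (a b t : nat) : nat := ((a * N.+1 + b) * (N + n) + t)%N.

Lemma act_cell_eq a b t a' b' t' : (b <= N)%N -> (b' <= N)%N -> (t < N + n)%N ->
    (t' < N + n)%N ->
  (act_cell a b t == act_cell a' b' t') = [&& a == a', b == b' & t == t'].
Proof. by move=> *; rewrite /act_cell !pair_index_eq // andbA. Qed.

Lemma act_loop_runs m k l :
    inputs n N q m -> nats m nLen 0 = k -> nats m nOpp 0 = l ->
    (0 < N)%N -> (k <= N)%N -> (l <= N)%N ->
  runs act_loop m ((N + n) * 120 + 100) (fun m' =>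
    let act t := ((k - t) * (1 - nats m nHold (l * N.+1 + (k - t))))%N in
    [/\ forall x i, x \notin [:: 1; 2; 12]%N -> nats m' x i = nats m x i,
        forall x i, reals m' x i = reals m x i,
        forall a b t, (a <= N)%N -> (b <= N)%N -> (t < N + n)%N ->
          nats m' nAct1 (act_cell a b t) =
          if (a == k) && (b == l) then act t else nats m nAct1 (act_cell a b t)
      & forall a b t, (a <= N)%N -> (b <= N)%N -> (t < N + n)%N ->
          nats m' nAct2 (act_cell a b t) =
          if (a == l) && (b == k) then act t else nats m nAct2 (act_cell a b t)]).
Proof.
move=> [iN iin iq] mk ml N0 kN lN.
pose act t := ((k - t) * (1 - nats m nHold (l * N.+1 + (k - t))))%N.
pose J r m' := nats m' nR 0 = r /\
    [/\ forall x i, x \notin [:: 1; 2; 12]%N -> nats m' x i = nats m x i,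
        forall x i, reals m' x i = reals m x i,
        forall a b t, (a <= N)%N -> (b <= N)%N -> (t < N + n)%N ->
          nats m' nAct1 (act_cell a b t) =
          if [&& a == k, b == l & (t < r)%N] then act t else nats m nAct1 (act_cell a b t)
      & forall a b t, (a <= N)%N -> (b <= N)%N -> (t < N + n)%N ->
          nats m' nAct2 (act_cell a b t) =
          if [&& a == l, b == k & (t < r)%N] then act t else nats m nAct2 (act_cell a b t)].
eapply runs_le.
  apply: runs_seq; apply: runs_nstore.
  set m1 := Memory _ _.
  have := @runs_for R nR (NSub (NAdd target faces) (NLit 1)) _ J 0 (N + n - 1)%N 90 m1.
  move=> H; apply: (runs_weaken (H _ _ _ _ _) (leqnn _)) => {H}.
  - by move=> r m' [m'r [fn _ _ _]]; split=> //=; rewrite !fn // iN iin.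
  - move=> r m' /= rN [m'r [fn fr f1 f2]]; eapply runs_le.
      have e1 : neval m' (act_index (scal nLen) (scal nOpp)) = act_cell k l r.
        by rewrite /= m'r !fn // iN iin mk ml !addn1.
      have e2 : neval m' (act_index (scal nOpp) (scal nLen)) = act_cell l k r.
        by rewrite /= m'r !fn // iN iin mk ml !addn1.
      have ea : neval m' act_exp = act r by rewrite /= m'r !fn // iN mk ml !addn1.
      apply: runs_seq; apply: runs_nstore; apply: runs_nstore.
      set m2 := Memory (upd (nats m') _ _ _) (reals m').
      have -> : neval m2 (act_index (scal nOpp) (scal nLen)) = act_cell l k r by rewrite -e2.
      have -> : neval m2 act_exp = act r by rewrite -ea.
      rewrite /m2 e1 ea => {m2}.
      have rNn : (r < N + n)%N by lia.
      split=> //; split=> //; split=> //=.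
      + by move=> x i hx; move: (hx); rewrite !inE => /norP[h1 /norP[h2 h3]];
          rewrite /upd (negPf h1) (negPf h2) (negPf h3) /= fn.
      + move=> a b t aN bN tN; rewrite /upd /= act_cell_eq // f1 // ltnS (leq_eqVlt t).
        by case: eqP => [->|] //=; case: eqP => [->|] //=; case: eqP => [->|].
      + move=> a b t aN bN tN; rewrite /upd /= act_cell_eq // f2 // ltnS (leq_eqVlt t).
        by case: eqP => [->|] //=; case: eqP => [->|] //=; case: eqP => [->|].
    by [].
  - by [].
  - split=> //; split=> //.
    + move=> x i; rewrite !inE => /norP[h1 /norP[h2 h3]].
      by rewrite /= /upd (negPf h3).
    + by move=> a b t *; rewrite !andbF.
    + by move=> a b t *; rewrite !andbF.
  - move=> m' [_ [fn fr f1 f2]]; split=> // a b t aN bN tN.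
      by rewrite f1 // (_ : (t < _)%N) ?andbT //; lia.
    by rewrite f2 // (_ : (t < _)%N) ?andbT //; lia.
by rewrite /=; lia.
Qed.

End ActLoop.

(** * Solving a pair and the main program *)

(** Solution by elimination of [y = 1 - (B0 + (B1 - B0) z)] and [z = 1 - (A0 + (A1 - A0) y)], with
    [A0], [A1] in [rA0], [rA1] and [B0], [B1] in [rE0], [rE1] at [nLen]. *)
Definition y_exp :=
  RDiv (RAdd (RSub (RLit 1) (RLoad rE1 (scal nLen)))
             (RMul (RSub (RLoad rE1 (scal nLen)) (RLoad rE0 (scal nLen))) (rscal rA0)))
       (RSub (RLit 1) (RMul (RSub (rscal rA1) (rscal rA0))
                            (RSub (RLoad rE1 (scal nLen)) (RLoad rE0 (scal nLen))))).

Definition z_exp :=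
  RSub (RLit 1) (RAdd (rscal rA0) (RMul (RSub (rscal rA1) (rscal rA0)) (rscal rY))).

Definition solve : program :=
  Seq (NStore nLen (NLit 0) (scal nA))
  (Seq (NStore nOpp (NLit 0) (scal nB))
  (Seq line_loop
  (Seq (RStore rA0 (NLit 0) (RLoad rE0 (scal nLen)))
  (Seq (RStore rA1 (NLit 0) (RLoad rE1 (scal nLen)))
  (Seq (RStore rBreakA (NLit 0) (rscal rBreak))
  (Seq (NStore nBreakA (NLit 0) (scal nBreak))
  (Seq (NStore nLen (NLit 0) (scal nB))
  (Seq (NStore nOpp (NLit 0) (scal nA))
  (Seq line_loop
  (Seq (RStore rY (NLit 0) y_exp)
       (RStore rZ (NLit 0) z_exp))))))))))).

Definition record : program :=
  Seq (RStore rVal (cell (scal nA) (scal nB)) (RSub (RLit 1) (rscal rZ)))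
  (Seq (RStore rVal (cell (scal nB) (scal nA)) (RSub (RLit 1) (rscal rY)))
  (Seq act_loop
  (Seq (NStore nLen (NLit 0) (scal nA))
  (Seq (NStore nOpp (NLit 0) (scal nB))
  (Seq act_loop
  (If (NLe (NAdd (scal nB) (NLit 1)) (scal nA))
    (NStore nB (NLit 0) (NAdd (scal nB) (NLit 1)))
    (Seq (NStore nA (NLit 0) (NAdd (scal nA) (NLit 1)))
         (NStore nB (NLit 0) (NLit 1))))))))).

(** Each round changes at most one decision and then evaluates both pieces afresh, which is
    affordable because the number of rounds is quadratic. *)
Definition main_body : program :=
  Seq solve
  (If (TNot (RLe (rscal rBreakA) (rscal rY)))
    (NStore nHold (cell (scal nB) (scal nBreakA)) (NLit 1))
  (If (TNot (RLe (rscal rBreak) (rscal rZ)))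
    (NStore nHold (cell (scal nA) (scal nBreak)) (NLit 1))
    record)).

Definition pig_solver : program :=
  Seq (NStore nA (NLit 0) (NLit 1))
  (Seq (NStore nB (NLit 0) (NLit 1))
  (Seq (While (NLe (scal nA) target) main_body)
    (RStore rOut (NLit 0) (RLoad rVal (cell target target))))).

(** * The state of the lists and the linear system *)

Section MainLoop.
Variables (R : realType) (n : nat) (p : 'I_n.+1 -> R) (N : nat).
Hypothesis die_p : is_die p.
Implicit Types m : memory R.

Local Notation q := (face_prob p).
Local Notation inputs := (inputs n N q).

Let q_ge0 := face_prob_ge0 die_p.
Let q_sum := face_prob_sum die_p.
Let q0_lt1 := face_prob0_lt1 die_p.

Definition hold_bit m (l r : nat) : bool := (nats m nHold (l * N.+1 + r) != 0)%N.

Definition list_ok m (l k : nat) : Prop :=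
  [/\ forall r, (0 < r < k)%N -> reals m rVal (l * N.+1 + r) = turn_value p l r,
      forall r, (k <= r <= N)%N -> ~~ hold_bit m l r
    & exists2 top, bank p l k <= top &
        follow_optimal n q (hold_bit m l) (bank p l) k top].

(* Arrays with a smaller number hold data, those with a larger one registers. *)
Definition same_data m m' : Prop := forall x i, (x < 10)%N ->
  nats m' x i = nats m x i /\ reals m' x i = reals m x i.

Lemma same_data_frame m m1 m2 : same_data m m1 -> frame m1 m2 -> same_data m m2.
Proof.
move=> s1 [fn fr] x i x10; have [<- <-] := s1 x i x10.
by rewrite fn ?fr //; lia.
Qed.

Lemma same_data_nstore m f g x i v : (10 <= x)%N -> same_data m (Memory f g) ->
  same_data m (Memory (upd f x i v) g).
Proof.
move=> hx s y j hy; have [/= <- <-] := s y j hy; split=> //.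
by rewrite /upd; case: eqP => // e; lia.
Qed.

Lemma same_data_rstore m f g x i v : (10 <= x)%N -> same_data m (Memory f g) ->
  same_data m (Memory f (upd g x i v)).
Proof.
move=> hx s y j hy; have [/= <- <-] := s y j hy; split=> //.
by rewrite /upd; case: eqP => // e; lia.
Qed.

Lemma same_data_inputs m m' : same_data m m' -> inputs m -> inputs m'.
Proof.
move=> s [iN iin iq]; split=> [||i]; first by case: (s nIn 0%N isT) => ->.
  by case: (s nIn 1%N isT) => ->.
by case: (s rFace i isT) => _ ->.
Qed.

Definition line m l k (x : R) : R := roll n q (follow (hold_bit m l) (bank p l)) x k.

Definition break_at m l k (th : R) (r : nat) : Prop :=
  last_break n q (hold_bit m l) (bank p l) k th r.

Lemma line_runs m m1 l k :
    inputs m -> same_data m m1 -> nats m1 nLen 0 = k -> nats m1 nOpp 0 = l ->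
    (0 < k <= N)%N -> list_ok m l k ->
  runs line_loop m1 (N * (n * 45 + 300) + 300) (fun m' =>
    [/\ frame m1 m', reals m' rE0 k = line m l k 0, reals m' rE1 k = line m l k 1
      & break_at m l k (reals m' rBreak 0) (nats m' nBreak 0)]).
Proof.
move=> inm s mk ml /andP[k0 kN] [vals nh _].
have inm1 := same_data_inputs s inm.
have := @line_loop_runs R n N q m1 l k (hold_bit m l) (bank p l) inm1 mk ml.
move=> H; apply: (runs_weaken (H _ _ k0 _)) => //.
- by move=> r _; rewrite /hold_bit; case: (s nHold (l * N.+1 + r)%N isT) => ->.
- move=> r rk; case: (s rVal (l * N.+1 + r)%N isT) => _ ->.
  by rewrite vals.
- by apply: nh; rewrite leqnn.
- by rewrite leq_add2r leq_mul2r kN orbT.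
Qed.

Lemma line_contractive m l k : contractive (line m l k).
Proof.
by apply: roll_contractive => //; exact: follow_nonexpansive.
Qed.

Lemma lineE m l k x : line m l k x = line m l k 0 + (line m l k 1 - line m l k 0) * x.
Proof. exact: roll_affine. Qed.

Lemma line_slope m l k : 0 <= line m l k 1 - line m l k 0 < 1.
Proof. by have := @line_contractive m l k 0 1 ltr01; rewrite subr0. Qed.

Lemma solve_runs m a b :
    inputs m -> nats m nA 0 = a -> nats m nB 0 = b ->
    (0 < a <= N)%N -> (0 < b <= N)%N -> list_ok m b a -> list_ok m a b ->
  runs solve m (2 * (N * (n * 45 + 300) + 300) + 200) (fun m' =>
    [/\ same_data m m', nats m' nLen 0 = b, nats m' nOpp 0 = a
      & [/\ reals m' rY 0 = 1 - line m a b (reals m' rZ 0),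
            reals m' rZ 0 = 1 - line m b a (reals m' rY 0),
            break_at m b a (reals m' rBreakA 0) (nats m' nBreakA 0)
          & break_at m a b (reals m' rBreak 0) (nats m' nBreak 0)]]).
Proof.
move=> inm ma mb aN bN okb oka; eapply runs_le.
  do 2!(apply: runs_seq; apply: runs_nstore); apply: runs_seq.
  set m1 := Memory _ _.
  have s1 : same_data m m1 by do 2!apply: same_data_nstore => //.
  apply: (runs_weaken (line_runs inm s1 ma mb aN okb) (leqnn _)).
  move=> m2 [fr2 e0 e1 br].
  have s2 := same_data_frame s1 fr2.
  have m2k : nats m2 nLen 0 = a by case: fr2 => -> //.
  clearbody m1; clear m1 s1 fr2.
  do 3!(apply: runs_seq; apply: runs_rstore).
  do 3!(apply: runs_seq; apply: runs_nstore); apply: runs_seq.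
  set m3 := Memory _ _.
  have s3 : same_data m m3.
    do 3!apply: same_data_nstore => //; do 2!apply: same_data_rstore => //.
    exact: (@same_data_rstore m (nats m2) (reals m2) rA0 0%N _ isT s2).
  have m3b : nats m3 nLen 0 = b.
    by rewrite /m3 /= /upd /=; case: (s2 nB 0%N isT) => ->.
  have m3a : nats m3 nOpp 0 = a.
    by rewrite /m3 /= /upd /=; case: (s2 nA 0%N isT) => ->.
  have m3A0 : reals m3 rA0 0 = line m b a 0 by rewrite /m3 /= /upd /= m2k.
  have m3A1 : reals m3 rA1 0 = line m b a 1 by rewrite /m3 /= /upd /= m2k.
  have m3br : break_at m b a (reals m3 rBreakA 0) (nats m3 nBreakA 0) by [].
  clearbody m3; clear m2k s2 e0 e1 br.
  apply: (runs_weaken (line_runs inm s3 m3b m3a bN oka) (leqnn _)).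
  move=> m4 [fr4 e0 e1 br].
  have s4 := same_data_frame s3 fr4.
  move: fr4 => [fn fr].
  have m4b : nats m4 nLen 0 = b by rewrite fn.
  have m4A0 : reals m4 rA0 0 = line m b a 0 by rewrite fr.
  have m4A1 : reals m4 rA1 0 = line m b a 1 by rewrite fr.
  have m4br : break_at m b a (reals m4 rBreakA 0) (nats m4 nBreakA 0) by rewrite fr // fn.
  have m4a : nats m4 nOpp 0 = a by rewrite fn.
  clear m3 s3 m3b m3a m3A0 m3A1 m3br fn fr.
  apply: runs_seq; do 2!apply: runs_rstore.
  split=> //.
    apply: same_data_rstore => //.
    exact: (@same_data_rstore m (nats m4) (reals m4) rY 0%N _ isT s4).
  split=> //=; rewrite /upd /= m4b m4A0 m4A1 e0 e1; last by rewrite -lineE.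
  rewrite [in RHS]lineE; have /andP[] := line_slope m a b; have /andP[] := line_slope m b a.
  move: (line m b a 0) (line m b a 1) (line m a b 0) (line m a b 1) => x0 x1 y0 y1.
  (* The determinant is positive since both slopes lie in [0, 1). *)
  move=> A0 A1 B0 B1; have d0 : 1 - (x1 - x0) * (y1 - y0) != 0.
    by apply: lt0r_neq0; nra.
  by field.
by rewrite /=; lia.
Qed.

End MainLoop.

(* The pairs [(i, l)] that have been solved when [(a, b)] is the current pair are
   those with [i < next_need a b l]. *)
Definition next_need (a b l : nat) : nat :=
  if (l < b)%N then a.+1 else if (l < a)%N then a else if l == a then b else 1.

(** The pair [(N.+1, 1)] is where the main loop stops. *)
Definition pair_ok (N a b : nat) : bool :=
  (0 < b <= a)%N && ((a <= N)%N || (a == N.+1) && (b == 1%N)).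

Lemma next_need_le N a b l : pair_ok N a b -> (0 < l <= N)%N -> (next_need a b l <= N.+1)%N.
Proof.
rewrite /pair_ok /next_need => ab lN; do !case: ifP => ?; lia.
Qed.

Lemma next_need_current a b : (0 < b <= a)%N ->
  next_need a b b = a /\ next_need a b a = b.
Proof.
by move=> ab; split; rewrite /next_need; do !case: ifP => ?; lia.
Qed.

Definition next_pair a b : nat * nat := if (b < a)%N then (a, b.+1) else (a.+1, 1%N).

Lemma next_need_next a b l : (0 < b <= a)%N -> (0 < l)%N ->
  next_need (next_pair a b).1 (next_pair a b).2 l =
  if l == b then a.+1 else if l == a then b.+1 else next_need a b l.
Proof.
rewrite /next_need /next_pair => ab l0.
by case: (ltnP b a) => ba /=; do !case: ifP => ? //; lia.
Qed.

(** * The main loop *)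

Section MainStep.
Variables (R : realType) (n : nat) (p : 'I_n.+1 -> R) (N : nat).
Hypothesis die_p : is_die p.
Implicit Types m : memory R.

Local Notation q := (face_prob p).
Local Notation inputs := (inputs n N q).
Local Notation holds := (hold_bit N).
Local Notation list_ok := (list_ok p N).
Local Notation line := (line p N).
Local Notation break_at := (break_at p N).
Local Notation act_cell := (act_cell n N).

Let q_ge0 := face_prob_ge0 die_p.
Let q_sum := face_prob_sum die_p.
Let q0_lt1 := face_prob0_lt1 die_p.

Lemma bankE a b : (0 < a)%N -> (0 < b)%N ->
  bank p b a = 1 - roll n q (best (bank p a)) (bank p a b) b.
Proof. by move=> a0 b0; rewrite {1}/bank turn_valueE. Qed.

Lemma best_contractive l k : contractive (fun x => roll n q (best (bank p l)) x k).
Proof. by apply: roll_contractive => //; exact: best_nonexpansive. Qed.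

Lemma line_best m l k x : (0 < k)%N ->
  follow_optimal n q (holds m l) (bank p l) k x ->
  line m l k x = roll n q (best (bank p l)) x k.
Proof. by move=> k0 opt; apply: follow_optimal_roll opt _; rewrite k0 leqnn. Qed.

Lemma follow_optimal_at m l k th r top x :
    follow_optimal n q (holds m l) (bank p l) k top -> break_at m l k th r ->
    th <= x <= top ->
  follow_optimal n q (holds m l) (bank p l) k x.
Proof. by move=> opt br xP; apply: (follow_optimal_between _ _ _ opt br xP). Qed.

Lemma break_le_top m l k th r top :
    follow_optimal n q (holds m l) (bank p l) k top -> bank p l k <= top ->
    break_at m l k th r -> th <= top.
Proof.
move=> opt le_top br; apply: (last_break_le_top _ _ _ opt _ br) => //.
by apply: le_trans le_top; case/andP: (bank_bounds die_p l k).
Qed.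

(** The break [th] is a point of contact for the first line. The list behind the second may still
    contain wrong rolls, but its line lies below its function in any case. *)
Lemma solution_lt m a b th r y z :
    (0 < a)%N -> (0 < b)%N -> list_ok m b a -> break_at m b a th r ->
    y = 1 - line m a b z -> z = 1 - line m b a y -> y < th ->
  bank p b a < th.
Proof.
move=> a0 b0 [_ _ [top le_top opt]] br ey ez.
have th_top := break_le_top opt le_top br.
apply: (crossing_lt (best_contractive b a) (best_contractive a b)
  (line_contractive N die_p m b a) (line_contractive N die_p m a b)
  (bankE a0 b0) (bankE b0 a0) ey ez).
  by move=> x; apply: roll_follow_le_best.
by rewrite line_best //; apply: follow_optimal_at opt br _; rewrite lexx.
Qed.

Lemma solution_eq m a b th th' r r' y z :
    (0 < a)%N -> (0 < b)%N -> list_ok m b a -> list_ok m a b ->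
    break_at m b a th r -> break_at m a b th' r' ->
    y = 1 - line m a b z -> z = 1 - line m b a y -> th <= y -> th' <= z ->
  [/\ bank p b a = y, bank p a b = z,
      follow_optimal n q (holds m b) (bank p b) a (bank p b a)
    & follow_optimal n q (holds m a) (bank p a) b (bank p a b)].
Proof.
move=> a0 b0 [_ _ [top le_top opt]] [_ _ [top' le_top' opt']] br br' ey ez le_y le_z.
have th_top := break_le_top opt le_top br.
have th_top' := break_le_top opt' le_top' br'.
have opt_at x : th <= x <= top -> follow_optimal n q (holds m b) (bank p b) a x.
  exact: follow_optimal_at opt br.
have opt_at' x : th' <= x <= top' -> follow_optimal n q (holds m a) (bank p a) b x.
  exact: follow_optimal_at opt' br'.
have [yE zE] : bank p b a = y /\ bank p a b = z.
  apply: (crossing_eq (th := th) (th' := th') (top := top) (top' := top')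
    (best_contractive b a) (best_contractive a b)
    (line_contractive N die_p m b a) (line_contractive N die_p m a b)
    (bankE a0 b0) (bankE b0 a0) ey ez) => //.
  - by move=> x /opt_at/line_best->.
  - by move=> x /opt_at'/line_best->.
  - by rewrite line_best.
  - by rewrite line_best.
split=> //; first by apply: opt_at; rewrite le_top yE le_y.
by apply: opt_at'; rewrite le_top' zE le_z.
Qed.

Lemma follow_optimal_ext h h' (c : nat -> R) a y :
    (forall r, (0 < r < a)%N -> h r = h' r) ->
  follow_optimal n q h c a y -> follow_optimal n q h' c a y.
Proof.
move=> eh opt; have ea r : (r < a)%N ->
    after n q (follow h c) y r = after n q (follow h' c) y r.
  elim/ltn_ind: r => -[//|r] IH ra; rewrite !afterS // {1 3}/follow eh //.
  rewrite (@roll_ext _ _ _ (follow h c) (follow h' c) y y r.+1) // => s sr.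
  by apply: IH => //; apply: ltn_trans ra.
move=> r ra; have := opt r ra; rewrite eh //.
rewrite (@roll_ext _ _ _ (follow h c) (follow h' c) y y r) //; first by case/andP: ra.
by move=> s sr; apply: ea; apply: (ltn_trans sr); case/andP: ra.
Qed.

Lemma list_ok_ext m m' l k : (k <= N.+1)%N ->
    (forall r, (0 < r < k)%N ->
       reals m' rVal (l * N.+1 + r) = reals m rVal (l * N.+1 + r)) ->
    (forall r, (r <= N)%N -> holds m' l r = holds m l r) ->
  list_ok m l k -> list_ok m' l k.
Proof.
move=> kN er eh [vals nh [top le_top opt]]; split.
- by move=> r rk; rewrite er // vals.
- by move=> r /andP[kr rN]; rewrite eh // nh // kr.
- exists top => //; apply: follow_optimal_ext opt => r /andP[_ rk].
  by rewrite eh // -ltnS (leq_trans rk).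
Qed.

Definition outs_ok m k l : Prop :=
  good_actions p (fun t => nats m nAct1 (act_cell k l t) != 0)%N k l /\
  good_actions p (fun t => nats m nAct2 (act_cell l k t) != 0)%N k l.

Definition inv_at m a b : Prop :=
  [/\ inputs m, nats m nA 0 = a, nats m nB 0 = b & pair_ok N a b] /\
  [/\ forall l, (0 < l <= N)%N -> list_ok m l (next_need a b l)
    & forall k l, (0 < k <= N)%N -> (0 < l <= N)%N -> (k < next_need a b l)%N ->
        outs_ok m k l].

Definition solver_inv m : Prop := exists a b, inv_at m a b.

Definition rolls m : nat := (\sum_(i < N.+1 * N.+1) (nats m nHold i == 0))%N.

(* Every iteration of the main loop either turns a roll into a hold for good or
   proceeds to the next pair. *)
Definition work m : nat :=
  (N.+1 * (N.+1 - nats m nA 0) + (N.+1 - nats m nB 0) + rolls m)%N.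

Lemma same_data_list_ok m m' l k : same_data m m' -> list_ok m l k -> list_ok m' l k.
Proof.
move=> s [vals nh [top le_top opt]].
have eh r : holds m' l r = holds m l r.
  by rewrite /hold_bit; case: (s nHold (l * N.+1 + r)%N isT) => ->.
split.
- by move=> r rk; case: (s rVal (l * N.+1 + r)%N isT) => _ ->; apply: vals.
- by move=> r rk; rewrite eh nh.
- by exists top => //; apply: follow_optimal_ext opt => r _; rewrite eh.
Qed.

Lemma same_data_inv_at m m' a b : same_data m m' -> inv_at m a b -> inv_at m' a b.
Proof.
move=> s [[inm ma mb ab] [lists outs]]; split; split=> //.
- exact: same_data_inputs s inm.
- by case: (s nA 0%N isT) => ->.
- by case: (s nB 0%N isT) => ->.
- by move=> l lN; apply: same_data_list_ok s (lists l lN).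
- move=> k l kN lN kl; have [g1 g2] := outs k l kN lN kl.
  rewrite /outs_ok; split.
    by under eq_fun => t do case: (s nAct1 (act_cell k l t) isT) => ->.
  by under eq_fun => t do case: (s nAct2 (act_cell l k t) isT) => ->.
Qed.

(** The break becomes the new [top]: the changed list is still optimal there, and the value sought
    lies below. *)
Lemma flip_inv m a b l th r :
    inv_at m a b -> (0 < l <= N)%N -> (0 < next_need a b l <= N)%N ->
    break_at m l (next_need a b l) th r -> bank p l (next_need a b l) < th ->
  let m' := Memory (upd (nats m) nHold (l * N.+1 + r) 1%N) (reals m) in
  inv_at m' a b /\ (work m' < work m)%N.
Proof.
move=> [[inm ma mb ab] [lists outs]] lN kN br lt_th m'.
set k := next_need a b l in kN br lt_th *.
have [vals nh [top le_top opt]] := lists l lN; rewrite -/k in vals nh le_top opt.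
have bank0 : 0 <= bank p l k by case/andP: (bank_bounds die_p l k).
have th_top := break_le_top opt le_top br.
have opt_th : follow_optimal n q (holds m l) (bank p l) k th.
  by apply: follow_optimal_at opt br _; rewrite lexx.
have [/andP[r0 rk] hr opt'] := follow_optimal_flip opt_th br (le_lt_trans bank0 lt_th).
have rN : (r < N.+1)%N by case/andP: kN => _ kN; rewrite ltnS ltnW // (leq_trans rk).
have eh l' s : (s <= N)%N -> holds m' l' s = ((l' == l) && (s == r)) || holds m l' s.
  by move=> sN; rewrite /hold_bit /m' /= /upd /= pair_index_eq //; case: ifP.
split; last first.
  rewrite /work /= ltn_add2l /rolls.
  have i0 : (l * N.+1 + r < N.+1 * N.+1)%N by case/andP: lN => _ lN; nia.
  rewrite (bigD1 (Ordinal i0)) //= [ltnRHS](bigD1 (Ordinal i0)) //=.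
  rewrite /upd /= eqxx /= add0n; move: hr; rewrite /hold_bit negbK => ->.
  by rewrite add1n ltnS; apply: leq_sum => i _; case: ifP.
split; split=> //.
- move=> l' l'N; have [el|nl] := eqVneq l' l.
    rewrite el -/k; split.
    + exact: vals.
    + move=> s /andP[ks sN]; rewrite eh // eqxx /= negb_or nh ?ks // andbT.
      by apply: contraTneq ks => ->; rewrite -ltnNge.
    + exists th; first exact: ltW.
      apply: follow_optimal_ext opt' => s /andP[_ sk].
      by rewrite eh ?eqxx // ltnW // (leq_trans sk) //; case/andP: kN.
  apply: list_ok_ext (lists l' l'N) => //.
    exact: next_need_le.
  by move=> s sN; rewrite eh // (negPf nl).
Qed.

Lemma follow_optimal_extend m l k :
    (0 < k <= N)%N -> (0 < l)%N -> list_ok m l k ->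
    follow_optimal n q (holds m l) (bank p l) k (bank p l k) ->
  follow_optimal n q (holds m l) (bank p l) k.+1 (bank p l k).
Proof.
move=> /andP[k0 kN] l0 [_ nh _] opt r /andP[r0].
rewrite ltnS leq_eqVlt => /orP[/eqP->|rk]; last by apply: opt; rewrite r0.
rewrite (negPf (nh k _)) ?leqnn // (follow_optimal_roll opt) ?k0 //=.
by rewrite -turn_valueE // bank_le_turn_value.
Qed.

Lemma hold_actions_good m l k :
    (0 < k <= N)%N -> (0 < l)%N -> list_ok m l k ->
    follow_optimal n q (holds m l) (bank p l) k (bank p l k) ->
  good_actions p
    (fun t => (k - t) * (1 - nats m nHold (l * N.+1 + (k - t))) != 0)%N k l.
Proof.
move=> /andP[k0 kN] l0 [_ nh _] opt; split.
- rewrite subn0; have := nh k; rewrite leqnn kN => /(_ isT); rewrite /hold_bit negbK => /eqP->.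
  by rewrite muln1 -lt0n.
- by move=> t /andP[kt _]; rewrite (eqP (_ : k - t == 0)%N).
- move=> t /andP[t0 tk]; have ktk : (0 < k - t < k)%N by lia.
  rewrite -(follow_optimal_roll opt) ?(ltnW (proj2 (andP ktk))) ?andbT; last by lia.
  have := opt _ ktk; rewrite /hold_bit.
  case: (nats m _ _) => [|h] /=; first by rewrite muln1 -lt0n; case/andP: ktk => ->.
  by rewrite muln0.
Qed.

End MainStep.

(** * Recording a solved pair, and one round of the main loop *)

Section Record.
Variables (R : realType) (n : nat) (p : 'I_n.+1 -> R) (N : nat).
Hypothesis die_p : is_die p.
Implicit Types m : memory R.

Local Notation q := (face_prob p).
Local Notation inputs := (inputs n N q).
Local Notation holds := (hold_bit N).
Local Notation list_ok := (list_ok p N).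
Local Notation act_cell := (act_cell n N).
Local Notation inv_at := (inv_at p N).
Local Notation solver_inv := (solver_inv p N).
Local Notation outs_ok := (outs_ok p N).

Definition optimal_at m l k : Prop :=
  follow_optimal n q (holds m l) (bank p l) k (bank p l k).

Definition hold_action m l k t : nat :=
  ((k - t) * (1 - nats m nHold (l * N.+1 + (k - t))))%N.

Lemma good_actions_ext act act' k l : (0 < k <= N)%N ->
    (forall t, (t < N + n)%N -> act t = act' t) ->
  good_actions p act k l -> good_actions p act' k l.
Proof.
move=> kN e [g0 g1 g2]; split; first by rewrite -e //; lia.
- by move=> t tk; rewrite -e ?g1 //; lia.
- by move=> t tk; rewrite -e; [apply: g2|lia].
Qed.

Lemma list_ok_extend m m' l k :
    (0 < k <= N)%N -> (0 < l)%N -> list_ok m l k -> optimal_at m l k ->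
    (forall i, nats m' nHold i = nats m nHold i) ->
    (forall r, (r <= N)%N -> reals m' rVal (l * N.+1 + r) = turn_value p l r \/
       reals m' rVal (l * N.+1 + r) = reals m rVal (l * N.+1 + r)) ->
    reals m' rVal (l * N.+1 + k) = turn_value p l k ->
  list_ok m' l k.+1.
Proof.
move=> kN l0 ok opt eh ev evk.
have opt' := follow_optimal_extend die_p kN l0 ok opt.
have [vals nh _] := ok.
have eh' r : holds m' l r = holds m l r by rewrite /hold_bit eh.
split.
- move=> r /andP[r0]; rewrite ltnS leq_eqVlt => /orP[/eqP-> //|rk].
  have rN : (r <= N)%N by lia.
  by case: (ev r rN) => -> //; apply: vals; rewrite r0.
- by move=> r /andP[kr rN]; rewrite eh' nh // (ltnW kr).
- exists (bank p l k); first exact: bank_anti.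
  by apply: follow_optimal_ext opt' => r _; rewrite eh'.
Qed.

(** Stated for any memory with these contents, so that both exits of [record], the next pair in the
    row and a new row, are covered at once. *)
Lemma record_inv m m' a b :
    inv_at m a b -> (a <= N)%N -> optimal_at m b a -> optimal_at m a b ->
    inputs m' -> nats m' nA 0 = (next_pair a b).1 -> nats m' nB 0 = (next_pair a b).2 ->
    (forall i, nats m' nHold i = nats m nHold i) ->
    (forall l r, (r <= N)%N -> reals m' rVal (l * N.+1 + r) =
       if (l == a) && (r == b) || (l == b) && (r == a) then turn_value p l r
       else reals m rVal (l * N.+1 + r)) ->
    (forall k l t, (k <= N)%N -> (l <= N)%N -> (t < N + n)%N ->
       nats m' nAct1 (act_cell k l t) =
         (if (k == a) && (l == b) || (k == b) && (l == a) then hold_action m l k t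
          else nats m nAct1 (act_cell k l t)) /\
       nats m' nAct2 (act_cell l k t) =
         (if (k == a) && (l == b) || (k == b) && (l == a) then hold_action m l k t
          else nats m nAct2 (act_cell l k t))) ->
  solver_inv m' /\ (work N m' < work N m)%N.
Proof.
move=> [[inm ma mb ab] [lists outs]] aN optb opta inm' m'a m'b eh ev ea.
have ab' : (0 < b <= a)%N by case/andP: ab.
have [nb na] := next_need_current ab'.
have a0 : (0 < a)%N by lia.
have b0 : (0 < b)%N by lia.
have bN : (b <= N)%N by lia.
have okb : list_ok m b a by rewrite -{1}nb; apply: lists; rewrite b0.
have oka : list_ok m a b by rewrite -{1}na; apply: lists; rewrite a0.
have ev' l r : (r <= N)%N -> reals m' rVal (l * N.+1 + r) = turn_value p l r \/
    reals m' rVal (l * N.+1 + r) = reals m rVal (l * N.+1 + r).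
  by move=> rN; rewrite ev //; case: ifP; [left|right].
split; last first.
  rewrite /work /rolls; under eq_bigr do rewrite eh.
  (* A new row lowers the term in [a] by [N.+1] and raises the term in [b] by at most [N - 1]. *)
  by rewrite ltn_add2r m'a m'b ma mb /next_pair; case: ifP => /= ?; nia.
exists (next_pair a b).1, (next_pair a b).2; split; split=> //.
- by rewrite /pair_ok /next_pair; case: ifP => /= ?; lia.
- move=> l lN; rewrite next_need_next //; last by case/andP: lN.
  case: eqP => [->|/eqP nlb].
    apply: list_ok_extend okb optb eh _ _ => //; first by rewrite a0.
      by move=> r rN; apply: ev'.
    by rewrite ev // !eqxx orbT.
  case: eqP => [->|/eqP nla].
    apply: list_ok_extend oka opta eh _ _ => //; first by rewrite b0.
      by move=> r rN; apply: ev'.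
    by rewrite ev // !eqxx.
  have le := next_need_le ab lN.
  apply: list_ok_ext (lists l lN) => // [r /andP[_ rk]|r rN].
    by rewrite ev ?(negPf nla) ?(negPf nlb) //; lia.
  by rewrite /hold_bit eh.
- move=> k l kN lN; rewrite next_need_next //; last by case/andP: lN.
  have lN' : (l <= N)%N by case/andP: lN.
  have kN' : (k <= N)%N by case/andP: kN.
  have [new|old] := boolP ((k == a) && (l == b) || (k == b) && (l == a)).
    have good : good_actions p (fun t => hold_action m l k t != 0)%N k l.
      case/orP: new => /andP[/eqP-> /eqP->].
        by apply: hold_actions_good => //; rewrite ?a0.
      by apply: hold_actions_good => //; rewrite ?b0.
    move=> _; split; apply: good_actions_ext good => // t tN;
      by have [e1 e2] := ea k l t kN' lN' tN; rewrite ?e1 ?e2 new.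
  move: (old); rewrite negb_or !negb_and => /andP[old1 old2] kl.
  have [g1 g2] : outs_ok m k l.
    apply: outs => //; move: kl; case: eqP => [el|_].
      by rewrite el eqxx orbF in old1; rewrite el nb; lia.
    by case: eqP => [el|_] //; rewrite el eqxx orbF in old2; rewrite el na; lia.
  split; [apply: good_actions_ext g1|apply: good_actions_ext g2] => // t tN;
    by have [e1 e2] := ea k l t kN' lN' tN; rewrite ?e1 ?e2 (negPf old).
Qed.

Lemma record_runs m a b :
    inv_at m a b -> (a <= N)%N -> optimal_at m b a -> optimal_at m a b ->
    nats m nLen 0 = b -> nats m nOpp 0 = a ->
    reals m rY 0 = bank p b a -> reals m rZ 0 = bank p a b ->
  runs record m (2 * ((N + n) * 120 + 100) + 200)
    (fun m' => solver_inv m' /\ (work N m' < work N m)%N).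
Proof.
move=> im aN optb opta mlen mopp my mz.
have [[inm ma mb ab] _] := im; have [iN iin iq] := inm.
have ab' : (0 < b <= a)%N by case/andP: ab.
have bN : (b <= N)%N by lia.
have N0 : (0 < N)%N by lia.
eapply runs_le.
  do 2!(apply: runs_seq; apply: runs_rstore).
  set m1 := Memory _ _.
  have val1 l r : (r <= N)%N -> reals m1 rVal (l * N.+1 + r) =
       if (l == a) && (r == b) || (l == b) && (r == a) then turn_value p l r
       else reals m rVal (l * N.+1 + r).
    move=> rN; rewrite /m1 /= /upd /= iN ma mb addn1 my mz !pair_index_eq //.
    rewrite /bank; case: eqP => [->|_] /=.
      case: eqP => [->|_] /=; first by rewrite orbT opprB addrC subrK.
      rewrite orbF; case: eqP => [->|_] //=; case: eqP => [->|_] //=.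
      by rewrite opprB addrC subrK.
    rewrite orbF; case: eqP => [->|_] //=; case: eqP => [->|_] //=.
    by rewrite opprB addrC subrK.
  have in1 : inputs m1 by split=> //= i; rewrite /upd.
  have nat1 x i : nats m1 x i = nats m x i by [].
  clearbody m1.
  apply: runs_seq.
  have len1 : nats m1 nLen 0 = b by rewrite nat1.
  have opp1 : nats m1 nOpp 0 = a by rewrite nat1.
  apply: (runs_weaken (act_loop_runs in1 len1 opp1 N0 bN aN) (leqnn _)).
  move=> m2 [n2 r2 a21 a22].
  do 2!(apply: runs_seq; apply: runs_nstore).
  set m3 := Memory _ _.
  have in3 : inputs m3.
    split=> [||i]; rewrite /m3 /= /upd /=.
    - by rewrite n2 // nat1.
    - by rewrite n2 // nat1.
    - by rewrite r2; have [_ _ ->] := in1.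
  have len3 : nats m3 nLen 0 = a by rewrite /m3 /= /upd /= n2 // nat1.
  have opp3 : nats m3 nOpp 0 = b by rewrite /m3 /= /upd /= n2 // nat1.
  have n3 x i : x \notin [:: 1; 2; 10; 11; 12]%N -> nats m3 x i = nats m x i.
    rewrite !inE !negb_or => /and5P[h1 h2 h3 h4 h5].
    rewrite /m3 /= /upd (negPf h3) (negPf h4) /= n2 ?nat1 //.
    by rewrite !inE !negb_or h1 h2.
  have r3 x i : reals m3 x i = reals m1 x i by rewrite /m3 /= r2.
  have act3 x i : (x < 3)%N -> nats m3 x i = nats m2 x i.
    by case: x => [|[|[|x]]].
  clearbody m3.
  apply: runs_seq.
  apply: (runs_weaken (act_loop_runs in3 len3 opp3 N0 aN bN) (leqnn _)).
  move=> m4 [n4 r4 a41 a42].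
  have nat4 x i : x \notin [:: 1; 2; 10; 11; 12]%N -> nats m4 x i = nats m x i.
    move=> hx; rewrite n4 ?n3 //; move: hx; rewrite !inE !negb_or.
    by case/and5P=> -> -> _ _ ->.
  have fin m' : (forall x i, (x < 4)%N -> nats m' x i = nats m4 x i) ->
      (forall x i, reals m' x i = reals m4 x i) ->
      nats m' nA 0 = (next_pair a b).1 -> nats m' nB 0 = (next_pair a b).2 ->
      solver_inv m' /\ (work N m' < work N m)%N.
    move=> nm' rm' m'a m'b; apply: (record_inv im aN optb opta) => //.
    - split=> [||i]; rewrite ?nm' ?nat4 // rm' r4 r3.
      by have [_ _ ->] := in1.
    - by move=> i; rewrite nm' // nat4.
    - by move=> l r rN; rewrite rm' r4 r3 val1.
    - move=> k l t kN lN tN.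
      have h1 i : nats m1 nHold i = nats m nHold i by [].
      have h3 i : nats m3 nHold i = nats m nHold i by rewrite n3.
      rewrite !nm' // a41 // a42 // (act3 1%N) // (act3 2%N) // a21 // a22 // (nat1 1%N) (nat1 2%N) /hold_action.
      split.
        case: eqP => [->|_] /=.
          case: eqP => [->|_] /=; first by rewrite h3.
          by case: eqP => [->|_] //=; case: eqP => [->|_] //=; rewrite h1.
        by case: eqP => [->|_] //=; case: eqP => [->|_] //=; rewrite h1.
      rewrite ![(l == _) && _]andbC; case: eqP => [->|_] /=.
        case: eqP => [->|_] /=; first by rewrite h3.
        by case: eqP => [->|_] //=; case: eqP => [->|_] //=; rewrite h1.
      by case: eqP => [->|_] //=; case: eqP => [->|_] //=; rewrite h1.
  have a4 : nats m4 nA 0 = a by rewrite nat4.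
  have b4 : nats m4 nB 0 = b by rewrite nat4.
  apply: runs_if; rewrite /= a4 b4 addn1 => lt_ba.
    apply: runs_nstore; apply: fin => //=.
    - by move=> [|[|[|[|x]]]].
    - by rewrite /next_pair lt_ba /upd /= a4.
    - by rewrite /next_pair lt_ba /upd /= b4 addn1.
  apply: runs_seq; do 2!apply: runs_nstore; apply: fin => //=.
  - by move=> [|[|[|[|x]]]].
  - by rewrite /next_pair (negPf lt_ba) /upd /= a4 addn1.
  - by rewrite /next_pair (negPf lt_ba) /upd /=.
by rewrite /=; lia.
Qed.

Lemma main_body_runs m : solver_inv m -> (nats m nA 0 <= N)%N ->
  runs main_body m
    (2 * (N * (n * 45 + 300) + 300) + 2 * ((N + n) * 120 + 100) + 600)
    (fun m' => solver_inv m' /\ (work N m' < work N m)%N).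
Proof.
move=> [a [b im]] aN; have [[inm ma mb ab] [lists _]] := im.
rewrite ma in aN.
have ab' : (0 < b <= a)%N by case/andP: ab.
have a0 : (0 < a)%N by lia.
have b0 : (0 < b)%N by lia.
have bN : (b <= N)%N by lia.
have [nb na] := next_need_current ab'.
have okb : list_ok m b a by rewrite -{1}nb; apply: lists; rewrite b0.
have oka : list_ok m a b by rewrite -{1}na; apply: lists; rewrite a0.
have aN' : (0 < a <= N)%N by rewrite a0.
have bN' : (0 < b <= N)%N by rewrite b0.
eapply runs_le.
  apply: runs_seq.
  apply: (runs_weaken (solve_runs die_p inm ma mb aN' bN' okb oka) (leqnn _)).
  move=> m1 [s1 len1 opp1 [ey ez bra brb]].
  have im1 := same_data_inv_at s1 im.
  have [[inm1 ma1 mb1 _] _] := im1.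
  have iN : nats m1 0 0 = N by case: inm1.
  have eh l r : holds m1 l r = holds m l r.
    by rewrite /hold_bit; case: (s1 nHold (l * N.+1 + r)%N isT) => ->.
  have work1 : work N m1 = work N m.
    rewrite /work ma1 mb1 ma mb /rolls; congr (_ + _)%N.
    by apply: eq_bigr => i _; case: (s1 nHold i isT) => ->.
  have br1 l k th r : break_at p N m l k th r -> break_at p N m1 l k th r.
    by rewrite /break_at (_ : holds m1 l = holds m l) //; apply: funext => s.
  rewrite -work1; apply: runs_if => /= [|]; rewrite -ltNge => test1.
    apply: runs_nstore => /=; rewrite iN addn1 mb1.
    have lt := solution_lt die_p a0 b0 okb bra ey ez test1.
    rewrite -nb in lt bra aN'.
    have [im2 lt_work] := flip_inv die_p im1 bN' aN' (br1 _ _ _ _ bra) lt.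
    by split=> //; exists a, b.
  apply: runs_if => /= [|]; rewrite -ltNge => test2.
    apply: runs_nstore => /=; rewrite iN addn1 ma1.
    have lt := solution_lt die_p b0 a0 oka brb ez ey test2.
    rewrite -na in lt brb bN'.
    have [im2 lt_work] := flip_inv die_p im1 aN' bN' (br1 _ _ _ _ brb) lt.
    by split=> //; exists a, b.
  rewrite -leNgt in test1; rewrite -leNgt in test2.
  have [ey' ez' optb opta] := solution_eq die_p a0 b0 okb oka bra brb ey ez test1 test2.
  apply: (record_runs im1) => //.
  - by apply: follow_optimal_ext optb => r _; rewrite eh.
  - by apply: follow_optimal_ext opta => r _; rewrite eh.
by rewrite /=; lia.
Qed.

End Record.

(** * The complete run and its cost *)

(** There are at most [2 (N + 1) ^ 2 <= 8 N ^ 2] rounds of at most [N (330 n + 2300)] steps each;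
    raising 2300 to 2500 covers the initialization, the last test and the output. *)
Lemma pig_solver_runs (R : realType) (n : nat) (p : 'I_n.+1 -> R) (N : nat) :
    is_die p -> (0 < N)%N ->
  runs pig_solver (input p N) (8 * (330 * n + 2500) * N ^ 3) (fun m =>
    [/\ is_value N p (start N) (output_value m),
        optimal1 N p (@stationary R (output_action n N m))
      & optimal2 N p (@stationary R (output_action n N m))]).
Proof.
move=> die_p N0; eapply runs_le.
  do 2!(apply: runs_seq; apply: runs_nstore).
  set m0 := Memory _ _.
  have inv0 : solver_inv p N m0.
    exists 1%N, 1%N; split; split=> //.
    - by rewrite /pair_ok N0.
    - move=> l /andP[l0 lN].
      have -> : next_need 1 1 l = 1%N by rewrite /next_need; do !case: ifP => ? //; lia.
      split=> //; first by move=> [].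
      (* With [k = 1] there are no decisions yet, so any [top] is optimal. *)
      by exists (bank p l 1) => // -[].
    - move=> k l /andP[k0 _] /andP[l0 _]; rewrite /next_need.
      by do !case: ifP => ?; lia.
  have work0 : (work N m0 <= 2 * (N.+1 * N.+1))%N.
    rewrite /work /= mul2n -addnn leq_add //.
      by rewrite /m0 /= /upd /=; nia.
    rewrite /rolls -[leqRHS]muln1 -[X in (_ <= X * _)%N]card_ord -sum_nat_const.
    by apply: leq_sum => i _; case: eqP.
  clearbody m0; apply: runs_seq.
  have := @runs_while R (NLe (scal nA) target) main_body (solver_inv p N) (work N)
    (2 * (N * (n * 45 + 300) + 300) + 2 * ((N + n) * 120 + 100) + 600)%N m0.
  move=> H; apply: (runs_weaken (T' := (2 * (N.+1 * N.+1) * (5 +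
    (2 * (N * (n * 45 + 300) + 300) + 2 * ((N + n) * 120 + 100) + 600)) + 5)%N)
    (H _ inv0)) => {H}.
  - move=> m im mN; apply: main_body_runs => //.
    by move: mN => /=; have [a [b [[[-> _ _] _ _ _] _]]] := im.
  - by rewrite /= leq_add2r leq_mul2r work0 orbT.
  - move=> m [[a [b [[inm ma mb ab] [lists outs]]]]].
    have [iN iin iq] := inm; rewrite /= ma iN -ltnNge => Na.
    have [aE bE] : a = N.+1 /\ b = 1%N by move: ab; rewrite /pair_ok; lia.
    have nextE l : (0 < l <= N)%N -> next_need a b l = N.+1.
      by move=> lN; rewrite aE bE /next_need; do !case: ifP => ?; lia.
    have NN : (0 < N <= N)%N by rewrite N0 leqnn.
    apply: runs_rstore; set m' := Memory _ _.
    have good k l : (0 < k <= N)%N -> (0 < l <= N)%N ->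
        good_actions p (fun t => output_action n N m' (State k l t true)) k l /\
        good_actions p (fun t => output_action n N m' (State l k t false)) k l.
      move=> kN lN; have := outs k l kN lN; rewrite nextE // ltnS.
      by case/andP: (kN) => _ -> /(_ isT).
    have greedy_m' := good_actions_greedy die_p good.
    have u01 s (_ : is_state n N s) := game_value_bounds die_p s.
    have u_fix s (_ : is_state n N s) := game_valueE die_p s.
    split.
    + have -> : output_value m' = game_value p (start N).
        rewrite /output_value /m' /= /upd /= iN addn1.
        by have [-> //] := lists N NN; rewrite nextE // N0 /=.
      apply: (greedy_is_value die_p u01 u_fix greedy_m').
      by rewrite /is_state /start /need /= N0 leqnn.
    + exact: (greedy_optimal1 die_p u01 u_fix greedy_m').
    + exact: (greedy_optimal2 die_p u01 u_fix greedy_m').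
rewrite /=.
have body_le : (5 + (2 * (N * (n * 45 + 300) + 300) + 2 * ((N + n) * 120 + 100) + 600)
    <= N * (330 * n + 2300))%N by nia.
have work_le : (2 * (N.+1 * N.+1) <= 8 * (N * N))%N by nia.
have := leq_mul work_le body_le.
have N3 : (0 < N ^ 3)%N by rewrite expn_gt0 N0.
have -> : (8 * (N * N) * (N * (330 * n + 2300)) = 8 * ((330 * n + 2300) * N ^ 3))%N by ring.
rewrite -(mulnA 8); move: (330 * n)%N (N ^ 3)%N N3 (2 * _ * (5 + _))%N => z M M0 X le_X.
have : ((z + 2500) * M = (z + 2300) * M + 200 * M)%N by rewrite -mulnDl; congr (_ * _)%N; lia.
by move: ((z + 2500) * M)%N ((z + 2300) * M)%N le_X => Y Z; lia.
Qed.

(** A triple with [k <= i] becomes a state of player one in need of [i + 1] with turn score [k]; one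
    with [i < k] becomes a state of player two in need of [k + 1] with turn score [i]. The two
    halves fill the cube. *)
Lemma nstates_ge (n N : nat) : (N ^ 3 <= nstates n N)%N.
Proof.
pose f (x : 'I_N * 'I_N * 'I_N) : 'I_N.+1 * 'I_N.+1 * 'I_(N + n) * bool :=
  let: (i, j, k) := x in
  if (k <= i)%N then (lift ord0 i, lift ord0 j, lshift n k, true)
  else (lift ord0 j, lift ord0 k, lshift n i, false).
have f_inj : injective f.
  move=> [[i j] k] [[i' j'] k'].
  move=> /(congr1 (fun x => (val x.1.1.1, val x.1.1.2, val x.1.2, x.2))).
  rewrite /f; case: ifP => _; case: ifP => _ //= []; rewrite /bump /= => e1 e2 e3;
    by congr (_, _, _); apply: val_inj => /=; lia.
have -> : (N ^ 3 = #|[set f x | x in [set: 'I_N * 'I_N * 'I_N]]%SET|)%N.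
  by rewrite card_imset // cardsT !card_prod card_ord !expnS expn0 muln1 mulnA.
rewrite /nstates ltnW // ltnS; apply: subset_leq_card; apply/fintype.subsetP => _ /imsetP[[[i j] k] _ ->].
rewrite inE /f; have := ltn_ord i; have := ltn_ord j; have := ltn_ord k.
by case: ifP => ki; rewrite /is_state /need /= /bump /=; lia.
Qed.

Lemma bigO_le (R : realType) (T g : nat -> R) (K : R) :
    (\forall N \near \oo, `|T N| <= K * `|g N|) ->
  (T : nat -> R^o) =O_\oo (g : nat -> R^o).
Proof.
move=> le_Tg; apply/eqO_exP; exists (Num.max K 1); first by rewrite lt_max ltr01 orbT.
apply: filterS le_Tg => N le_N; apply: le_trans le_N _.
by rewrite ler_wpM2r // le_max lexx.
Qed.

(** The logarithm is pure slack, bounded below by [ln 2]. *)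
Lemma le_mul_ln (R : realType) (x y : R) : 0 <= x -> 2 <= y ->
  x <= (ln 2)^-1 * `|x * ln y|.
Proof.
move=> x0 y2; have l2 : 0 < ln 2 :> R by apply: ln_gt0; lra.
have ly : ln 2 <= ln y by rewrite ler_ln ?posrE //; lra.
rewrite ger0_norm; last by rewrite mulr_ge0 //; lra.
by rewrite mulrC ler_pdivlMr // ler_wpM2l.
Qed.

Theorem theorem3p1 (R : realType) :
  exists A : program,
  forall (n : nat) (p : 'I_n.+1 -> R), is_die p ->
  exists T : nat -> nat,
  [/\ forall N : nat, (1 <= N)%N ->
        exists m : memory R,
        [/\ exec A (input p N) m (T N),
            is_value N p (start N) (output_value m),
            optimal1 N p (@stationary R (output_action n N m))
          & optimal2 N p (@stationary R (output_action n N m))],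
      (fun N => (T N)%:R : R^o) =O_\oo
        (fun N => N%:R ^+ 3 * ln N%:R : R^o)
    & (fun N => (T N)%:R : R^o) =O_\oo
        (fun N => (nstates n N)%:R * ln (nstates n N)%:R : R^o)].
Proof.
exists pig_solver => n p die_p; pose K := (8 * (330 * n + 2500))%N.
(* [exec] is a relation, so the running times are chosen; at [N = 0] the choice is arbitrary. The
   program is the same for all dice, and only [K] depends on [n]. *)
have /choice[T TP] : forall N, exists t, (0 < N)%N -> (t <= K * N ^ 3)%N /\
    exists m : memory R,
      [/\ exec pig_solver (input p N) m t,
          is_value N p (start N) (output_value m),
          optimal1 N p (@stationary R (output_action n N m))
        & optimal2 N p (@stationary R (output_action n N m))].
  move=> N; have [->|N0] := posnP N; first by exists 0%N.
  have [m [t [ex tK [v o1 o2]]]] := pig_solver_runs die_p N0.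
  by exists t => _; split=> //; exists m.
have TK N : (0 < N)%N -> (T N)%:R <= K%:R * N%:R ^+ 3 :> R.
  by move=> /TP[le_T _]; rewrite -natrX -natrM ler_nat.
exists T; split=> [N /TP[_ //]||].
  apply: (@bigO_le _ _ _ (K%:R * (ln 2)^-1)); exists 2%N => // N /= N2.
  have N2R : 2 <= N%:R :> R by rewrite ler_nat.
  rewrite ger0_norm //; apply: le_trans (TK N _) _; first exact: ltn_trans N2.
  by rewrite -mulrA ler_wpM2l //; apply: le_mul_ln => //; rewrite exprn_ge0.
apply: (@bigO_le _ _ _ (K%:R * (ln 2)^-1)); exists 2%N => // N /= N2.
have N3 : 2 <= N%:R ^+ 3 :> R by rewrite -natrX ler_nat; nia.
rewrite ger0_norm //; apply: le_trans (TK N _) _; first exact: ltn_trans N2.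
rewrite -mulrA ler_wpM2l //.
have leS : N%:R ^+ 3 <= (nstates n N)%:R :> R by rewrite -natrX ler_nat nstates_ge.
by apply: (le_trans leS); apply: le_mul_ln => //; lra.
Qed.
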